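(* Let $p$ be a prime, let $g$ be a primitive root modulo $p$, and let $N<p^{1/2}$ be a positive integer. Then $$\frac{1}{p}\sum_{x=0}^{p-1}\left|\sum_{n\le N}e^{2\pi i\frac{x}{p}g^n}\right|\gg N^{1/48+o(1)},$$ where $o(1)$ denotes a quantity tending to $0$ as $N\to\infty$. *)

(* Defs.v *)
From Stdlib Require Import Reals ZArith Znumtheory Arith.
Open Scope R_scope.

Fixpoint sum0 (f : nat -> R) (n : nat) : R :=
  match n with
  | O => 0
  | S m => sum0 f m + f m
  end.

Definition primitive_root (p g : nat) : Prop :=
  Nat.modulo (Nat.pow g (p - 1)) p = 1%nat /\
  forall k : nat, (0 < k < p - 1)%nat -> Nat.modulo (Nat.pow g k) p <> 1%nat.

(* Complex modulus of sum_{n=1}^N e(x g^n / p), e(t) = exp(2 pi i t),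
   written out via real and imaginary parts. *)
Definition exp_sum_abs (p g N x : nat) : R :=
  let t := fun n : nat => 2 * PI * (INR x * (INR g) ^ (S n) / INR p) in
  sqrt ((sum0 (fun n => cos (t n)) N) ^ 2 + (sum0 (fun n => sin (t n)) N) ^ 2).

Definition avg_abs_sum (p g N : nat) : R :=
  / INR p * sum0 (fun x => exp_sum_abs p g N x) p.

(* Main.v *)
(** Let f(x) be the exponential sum and E the number of solutions of
    g^i + g^j = g^k + g^l with exponents in [1, N].  Since the mean of |f|^2 is at
    least N and the mean of |f|^4 is E, the mean of |f| is at least N^(3/2) E^(-1/2),
    so a power saving in E suffices.  Dividing by one of the powers, E is at most
    N^2 + N (2N + 1) J, where J is the largest number of solutions x = 1 + th y with
    x, y in {g^a : |a| <= N}.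

    Let X be the set of such x, |X| = n.  The ratios of elements of X take only O(N)
    values, so most pairs (c, e) of X have many solutions of c x = e x' in X, and each
    of them rewrites c - e as a difference of two elements of th {g^a : |a| <= 2N}.
    Take a suitable subset X' of X and the set R of the quotients (a - b) / (c - d) of
    its nonzero differences.  If r is in R and y1 + s r y2 takes distinct values on
    almost all pairs (y1, y2) of X', where s is a ratio of two values of y, then
    (c - d) y1 + s (a - b) y2 can be expanded in too many ways as a sum of ten terms
    from a set of size O(N), unless n^20 = O(N^19).  If s r is outside R the values
    are all distinct; so R is stable under most s, hence under some g^t with
    t = O(N / n).  As g is a primitive root, R is then so large that, because of
    N^2 < p, one of its elements has almost no collisions, and the same expansion
    applies to it.  This gives J = O(N^(19/20)) and the exponent 1/40. *)
Require Import Defs.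
From Stdlib Require Import Reals ZArith Znumtheory Arith Lra Lia.
Open Scope R_scope.

(** * Moments of the exponential sum *)

Lemma sum0_ext (f h : nat -> R) n :
  (forall i, (i < n)%nat -> f i = h i) -> sum0 f n = sum0 h n.
Proof.
  induction n as [|n IH]; intros H; simpl; [reflexivity|].
  rewrite IH by (intros; apply H; lia). rewrite H by lia. reflexivity.
Qed.

Lemma sum0_le (f h : nat -> R) n :
  (forall i, (i < n)%nat -> f i <= h i) -> sum0 f n <= sum0 h n.
Proof.
  induction n as [|n IH]; intros H; simpl; [lra|].
  apply Rplus_le_compat; [apply IH; intros|]; apply H; lia.
Qed.

Lemma sum0_plus (f h : nat -> R) n :
  sum0 (fun i => f i + h i) n = sum0 f n + sum0 h n.
Proof. induction n as [|n IH]; simpl; [|rewrite IH]; ring. Qed.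

Lemma sum0_scal (a : R) (f : nat -> R) n :
  sum0 (fun i => a * f i) n = a * sum0 f n.
Proof. induction n as [|n IH]; simpl; [|rewrite IH]; ring. Qed.

Lemma sum0_const (a : R) n : sum0 (fun _ => a) n = INR n * a.
Proof. induction n as [|n IH]; [simpl; ring|]. rewrite S_INR; simpl; rewrite IH; ring. Qed.

Lemma sum0_ge0 (f : nat -> R) n :
  (forall i, (i < n)%nat -> 0 <= f i) -> 0 <= sum0 f n.
Proof.
  intros H. replace 0 with (sum0 (fun _ => 0) n) by (rewrite sum0_const; ring).
  now apply sum0_le.
Qed.

Lemma sum0_term_le (f : nat -> R) n i :
  (forall i, (i < n)%nat -> 0 <= f i) -> (i < n)%nat -> f i <= sum0 f n.
Proof.
  induction n as [|n IH]; intros H hi; [lia|]; simpl.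
  destruct (Nat.eq_dec i n) as [->|ne].
  - assert (0 <= sum0 f n) by (apply sum0_ge0; intros; apply H; lia). lra.
  - assert (f i <= sum0 f n) by (apply IH; [intros; apply H|]; lia).
    assert (0 <= f n) by (apply H; lia). lra.
Qed.

Lemma sum0_exchange (f : nat -> nat -> R) n m :
  sum0 (fun i => sum0 (f i) m) n = sum0 (fun j => sum0 (fun i => f i j) n) m.
Proof.
  induction n as [|n IH]; simpl.
  - rewrite sum0_const; ring.
  - rewrite IH, <- sum0_plus; reflexivity.
Qed.

Lemma sum0_mult (f h : nat -> R) n m :
  sum0 f n * sum0 h m = sum0 (fun i => sum0 (fun j => f i * h j) m) n.
Proof.
  induction n as [|n IH]; simpl; [ring|].
  rewrite Rmult_plus_distr_r, IH, sum0_scal; reflexivity.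
Qed.

(** Each term contributes [sin ((x + 1/2) a) - sin ((x - 1/2) a)]. The factor [sin (a / 2)] stays on
    the left, so that no division occurs. *)
Lemma cos_sum_telescope (a : R) n :
  2 * sin (a / 2) * sum0 (fun x => cos (INR x * a)) n =
  sin ((INR n - 1 / 2) * a) + sin (a / 2).
Proof.
  induction n as [|n IH].
  - simpl. replace ((0 - 1 / 2) * a) with (- (a / 2)) by field. rewrite sin_neg; ring.
  - simpl sum0. rewrite Rmult_plus_distr_l, IH, S_INR.
    replace ((INR n + 1 - 1 / 2) * a) with (INR n * a + a / 2) by field.
    replace ((INR n - 1 / 2) * a) with (INR n * a - a / 2) by field.
    rewrite sin_plus, sin_minus; ring.
Qed.

Lemma cos_2PI_INR (k : nat) : cos (2 * PI * INR k) = 1.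
Proof.
  replace (2 * PI * INR k) with (0 + 2 * INR k * PI) by ring.
  rewrite cos_period; apply cos_0.
Qed.

Lemma cos_2PI_IZR (z : Z) : cos (2 * PI * IZR z) = 1.
Proof.
  destruct (Z_le_dec 0 z) as [h|h].
  - rewrite <- (Z2Nat.id z h), <- INR_IZR_INZ; apply cos_2PI_INR.
  - replace (2 * PI * IZR z) with (- (2 * PI * IZR (- z))) by (rewrite opp_IZR; ring).
    rewrite cos_neg, <- (Z2Nat.id (- z)) by lia.
    rewrite <- INR_IZR_INZ; apply cos_2PI_INR.
Qed.

Lemma sin_2PI_IZR (z : Z) : sin (2 * PI * IZR z) = 0.
Proof.
  apply sin_eq_0_1. exists (2 * z)%Z. rewrite mult_IZR; ring.
Qed.

Lemma cos_sum_multiple (p : nat) (z : Z) : (0 < p)%nat ->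
  sum0 (fun x => cos (2 * PI * (INR x * IZR (z * Z.of_nat p) / INR p))) p = INR p.
Proof.
  intros hp. assert (INR p <> 0) by (apply not_0_INR; lia).
  rewrite (sum0_ext _ (fun _ => 1)).
  - rewrite sum0_const; ring.
  - intros x _. rewrite mult_IZR, <- INR_IZR_INZ.
    replace (INR x * (IZR z * INR p) / INR p) with (IZR (Z.of_nat x * z)).
    + apply cos_2PI_IZR.
    + rewrite mult_IZR, <- INR_IZR_INZ; field; assumption.
Qed.

Lemma cos_sum_nonmultiple (p : nat) (z : Z) : (0 < p)%nat ->
  ~ (Z.of_nat p | z)%Z ->
  sum0 (fun x => cos (2 * PI * (INR x * IZR z / INR p))) p = 0.
Proof.
  intros hp hz. assert (hp' : INR p <> 0) by (apply not_0_INR; lia).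
  set (a := 2 * PI * IZR z / INR p).
  rewrite (sum0_ext _ (fun x => cos (INR x * a))).
  2: { intros x _. f_equal. unfold a. field; assumption. }
  (* Here [a / 2] is [PI z / p], a multiple of [PI] only when p divides z. *)
  assert (hs : sin (a / 2) <> 0).
  { intros h. apply sin_eq_0_0 in h. destruct h as [k hk]. apply hz. exists k.
    apply eq_IZR. rewrite mult_IZR, <- INR_IZR_INZ.
    unfold a in hk. assert (hPI := PI_RGT_0).
    apply (Rmult_eq_reg_l PI); [|lra].
    replace (PI * IZR z) with (2 * PI * IZR z / INR p / 2 * INR p) by (field; assumption).
    rewrite hk; ring. }
  assert (h := cos_sum_telescope a p).
  (* [p a] is a whole number of turns, so the two ends of the telescoped sum cancel. *)
  assert (e : sin ((INR p - 1 / 2) * a) = - sin (a / 2)).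
  { replace ((INR p - 1 / 2) * a) with (2 * PI * IZR z - a / 2)
      by (unfold a; field; assumption).
    rewrite sin_minus, sin_2PI_IZR, cos_2PI_IZR; ring. }
  rewrite e in h.
  assert (h2 : 2 * sin (a / 2) * sum0 (fun x => cos (INR x * a)) p = 0) by lra.
  apply Rmult_integral in h2. destruct h2 as [h2|h2]; [|exact h2].
  exfalso; apply hs; lra.
Qed.

Lemma mod_eq_divide (p u v : nat) : (0 < p)%nat ->
  (u mod p = v mod p)%nat <-> (Z.of_nat p | Z.of_nat u - Z.of_nat v)%Z.
Proof.
  intros hp. rewrite <- Z.mod_divide by lia.
  assert (e : (Z.of_nat u mod Z.of_nat p = Z.of_nat v mod Z.of_nat p)%Z <-> (u mod p = v mod p)%nat).
  { rewrite <- !Nat2Z.inj_mod. lia. }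
  rewrite <- e. split; intros h.
  - rewrite Zminus_mod, h, Z.sub_diag. apply Z.mod_0_l; lia.
  - apply Z.mod_divide in h; [|lia]. destruct h as [k hk].
    replace (Z.of_nat u) with (Z.of_nat v + k * Z.of_nat p)%Z by lia.
    apply Z.mod_add; lia.
Qed.

Definition same_residue (p u v : nat) : R :=
  if Nat.eqb (u mod p) (v mod p) then 1 else 0.

Lemma cos_orthogonality (p u v : nat) : (0 < p)%nat ->
  sum0 (fun x => cos (2 * PI * (INR x * (INR u - INR v) / INR p))) p =
  INR p * same_residue p u v.
Proof.
  intros hp. unfold same_residue.
  rewrite (sum0_ext _ (fun x => cos (2 * PI * (INR x * IZR (Z.of_nat u - Z.of_nat v) / INR p)))).
  2: { intros x _. rewrite minus_IZR, <- !INR_IZR_INZ. reflexivity. }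
  destruct (Nat.eqb_spec (u mod p) (v mod p)) as [h|h].
  - apply mod_eq_divide in h; [|assumption]. destruct h as [k hk].
    rewrite hk, cos_sum_multiple by assumption. ring.
  - rewrite cos_sum_nonmultiple; [ring|assumption|].
    intros hd. apply h. now apply mod_eq_divide.
Qed.

Lemma norm_square (t : nat -> R) N :
  (sum0 (fun i => cos (t i)) N) ^ 2 + (sum0 (fun i => sin (t i)) N) ^ 2 =
  sum0 (fun i => sum0 (fun j => cos (t i - t j)) N) N.
Proof.
  simpl. rewrite !Rmult_1_r, !sum0_mult, <- sum0_plus.
  apply sum0_ext; intros i _. rewrite <- sum0_plus.
  apply sum0_ext; intros j _. rewrite cos_minus; ring.
Qed.

(** Write |f|^4 as |f^2|^2, where f^2 has real part A^2 - B^2 and imaginary part 2AB. This grouping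
    sets [t i + t j] against [t k + t l], as in the energy. *)
Lemma norm_fourth (t : nat -> R) N :
  ((sum0 (fun i => cos (t i)) N) ^ 2 + (sum0 (fun i => sin (t i)) N) ^ 2) ^ 2 =
  sum0 (fun i => sum0 (fun j => sum0 (fun k => sum0 (fun l =>
    cos (t i + t j - (t k + t l))) N) N) N) N.
Proof.
  set (A := sum0 (fun i => cos (t i)) N). set (B := sum0 (fun i => sin (t i)) N).
  assert (e1 : A ^ 2 - B ^ 2 = sum0 (fun i => sum0 (fun j => cos (t i + t j)) N) N).
  { unfold A, B. replace (sum0 (fun i => cos (t i)) N ^ 2 - sum0 (fun i => sin (t i)) N ^ 2)
      with (sum0 (fun i => cos (t i)) N * sum0 (fun i => cos (t i)) N +
            -1 * (sum0 (fun i => sin (t i)) N * sum0 (fun i => sin (t i)) N)) by ring.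
    rewrite !sum0_mult, <- sum0_scal, <- sum0_plus.
    apply sum0_ext; intros i _. rewrite <- sum0_scal, <- sum0_plus.
    apply sum0_ext; intros j _. rewrite cos_plus; ring. }
  assert (e2 : 2 * A * B = sum0 (fun i => sum0 (fun j => sin (t i + t j)) N) N).
  { unfold A, B. replace (2 * sum0 (fun i => cos (t i)) N * sum0 (fun i => sin (t i)) N)
      with (sum0 (fun i => sin (t i)) N * sum0 (fun i => cos (t i)) N +
            sum0 (fun i => cos (t i)) N * sum0 (fun i => sin (t i)) N) by ring.
    rewrite !sum0_mult, <- sum0_plus.
    apply sum0_ext; intros i _. rewrite <- sum0_plus.
    apply sum0_ext; intros j _. rewrite sin_plus; ring. }
  replace ((A ^ 2 + B ^ 2) ^ 2) with ((A ^ 2 - B ^ 2) * (A ^ 2 - B ^ 2) + (2 * A * B) * (2 * A * B))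
    by ring.
  rewrite e1, e2, !sum0_mult, <- sum0_plus.
  apply sum0_ext; intros i _.
  rewrite (sum0_ext _ (fun k => sum0 (fun j => sum0 (fun l => cos (t i + t j) * cos (t k + t l)) N) N)).
  2: { intros k _. apply sum0_mult. }
  rewrite (sum0_ext (fun i0 => _ * sum0 _ N)
     (fun k => sum0 (fun j => sum0 (fun l => sin (t i + t j) * sin (t k + t l)) N) N)).
  2: { intros k _. apply sum0_mult. }
  rewrite (sum0_exchange (fun k j => sum0 (fun l => cos (t i + t j) * cos (t k + t l)) N)).
  rewrite (sum0_exchange (fun k j => sum0 (fun l => sin (t i + t j) * sin (t k + t l)) N)).
  rewrite <- sum0_plus. apply sum0_ext; intros j _.
  rewrite <- sum0_plus. apply sum0_ext; intros k _.
  rewrite <- sum0_plus. apply sum0_ext; intros l _.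
  rewrite (cos_minus (t i + t j)). ring.
Qed.

Definition additive_energy (p g N : nat) : R :=
  sum0 (fun i => sum0 (fun j => sum0 (fun k => sum0 (fun l =>
    same_residue p (g ^ S i + g ^ S j) (g ^ S k + g ^ S l)) N) N) N) N.

Lemma exp_sum_abs_ge0 p g N x : 0 <= exp_sum_abs p g N x.
Proof. apply sqrt_pos. Qed.

Lemma exp_sum_abs_square p g N x :
  exp_sum_abs p g N x ^ 2 =
  sum0 (fun i => sum0 (fun j =>
    cos (2 * PI * (INR x * (INR (g ^ S i) - INR (g ^ S j)) / INR p))) N) N.
Proof.
  unfold exp_sum_abs. rewrite pow2_sqrt by nra. rewrite norm_square.
  apply sum0_ext; intros i _; apply sum0_ext; intros j _.
  rewrite !pow_INR. f_equal. unfold Rdiv. ring.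
Qed.

Lemma exp_sum_abs_fourth p g N x :
  exp_sum_abs p g N x ^ 4 =
  sum0 (fun i => sum0 (fun j => sum0 (fun k => sum0 (fun l =>
    cos (2 * PI * (INR x * (INR (g ^ S i + g ^ S j) - INR (g ^ S k + g ^ S l)) / INR p)))
    N) N) N) N.
Proof.
  replace (exp_sum_abs p g N x ^ 4) with ((exp_sum_abs p g N x ^ 2) ^ 2) by ring.
  unfold exp_sum_abs. rewrite pow2_sqrt by nra. rewrite norm_fourth.
  apply sum0_ext; intros i _; apply sum0_ext; intros j _.
  apply sum0_ext; intros k _; apply sum0_ext; intros l _.
  rewrite !plus_INR, !pow_INR. f_equal. unfold Rdiv. ring.
Qed.

(** By orthogonality every term is nonnegative; the diagonal terms alone give the bound. *)
Lemma second_moment p g N : (0 < p)%nat ->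
  INR p * INR N <= sum0 (fun x => exp_sum_abs p g N x ^ 2) p.
Proof.
  intros hp.
  rewrite (sum0_ext _ _ _ (fun x _ => exp_sum_abs_square p g N x)).
  rewrite sum0_exchange.
  replace (INR p * INR N) with (sum0 (fun _ => INR p) N) by (rewrite sum0_const; ring).
  apply sum0_le; intros i hi. rewrite sum0_exchange.
  rewrite (sum0_ext _ (fun j => INR p * same_residue p (g ^ S i) (g ^ S j)))
    by (intros; now apply cos_orthogonality).
  replace (INR p) with (INR p * same_residue p (g ^ S i) (g ^ S i)) at 1
    by (unfold same_residue; rewrite Nat.eqb_refl; ring).
  apply (sum0_term_le (fun j => INR p * same_residue p (g ^ S i) (g ^ S j))); [|assumption].
  intros j _. unfold same_residue. assert (h := pos_INR p).
  destruct (Nat.eqb _ _); lra.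
Qed.

Lemma fourth_moment p g N : (0 < p)%nat ->
  sum0 (fun x => exp_sum_abs p g N x ^ 4) p = INR p * additive_energy p g N.
Proof.
  intros hp. unfold additive_energy.
  rewrite (sum0_ext _ _ _ (fun x _ => exp_sum_abs_fourth p g N x)).
  rewrite sum0_exchange, <- sum0_scal. apply sum0_ext; intros i _.
  rewrite sum0_exchange, <- sum0_scal. apply sum0_ext; intros j _.
  rewrite sum0_exchange, <- sum0_scal. apply sum0_ext; intros k _.
  rewrite sum0_exchange, <- sum0_scal. apply sum0_ext; intros l _.
  now apply cos_orthogonality.
Qed.

(** [lam] is any upper bound for sqrt (E / N); equality would give N^(3/2) E^(-1/2). *)
Lemma avg_abs_sum_ge p g N lam : (0 < p)%nat -> 0 < lam ->
  additive_energy p g N <= lam ^ 2 * INR N ->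
  INR N / lam <= avg_abs_sum p g N.
Proof.
  intros hp hl hE.
  assert (hP : 0 < INR p) by now apply lt_0_INR.
  assert (h2 := second_moment p g N hp).
  assert (h4 := fourth_moment p g N hp).
  set (S1 := sum0 (fun x => exp_sum_abs p g N x) p).
  set (S2 := sum0 (fun x => exp_sum_abs p g N x ^ 2) p) in *.
  set (S4 := sum0 (fun x => exp_sum_abs p g N x ^ 4) p) in *.
  (* Hoelder between L^1, L^2 and L^4, as the pointwise inequality
     a (a - lam)^2 (a + 2 lam) >= 0. *)
  assert (h : 3 * lam ^ 2 * S2 <= 2 * lam ^ 3 * S1 + S4).
  { unfold S1, S2, S4. rewrite <- !sum0_scal, <- sum0_plus.
    apply sum0_le; intros x _. assert (ha := exp_sum_abs_ge0 p g N x).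
    set (a := exp_sum_abs p g N x) in *.
    assert (0 <= a * (a - lam) ^ 2 * (a + 2 * lam)).
    { apply Rmult_le_pos; [apply Rmult_le_pos; [assumption|apply pow2_ge_0]|lra]. }
    nra. }
  unfold avg_abs_sum. fold S1.
  assert (hl3 : 0 < lam ^ 3) by now apply pow_lt.
  assert (h5 : 2 * lam ^ 2 * (INR p * INR N) <= 2 * lam ^ 3 * S1).
  { assert (INR p * additive_energy p g N <= INR p * (lam ^ 2 * INR N))
      by (apply Rmult_le_compat_l; lra).
    assert (0 < lam ^ 2) by now apply pow_lt.
    assert (3 * lam ^ 2 * (INR p * INR N) <= 3 * lam ^ 2 * S2)
      by (apply Rmult_le_compat_l; lra).
    nra. }
  apply (Rmult_le_reg_l (2 * lam ^ 3 * INR p)); [nra|].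
  replace (2 * lam ^ 3 * INR p * (INR N / lam)) with (2 * lam ^ 2 * (INR p * INR N)) by (field; lra).
  replace (2 * lam ^ 3 * INR p * (/ INR p * S1)) with (2 * lam ^ 3 * S1) by (field; lra).
  exact h5.
Qed.

(** * Choice of parameters *)

Lemma nat_floor (r : R) : 0 <= r -> exists k : nat, INR k <= r < INR k + 1.
Proof.
  intros hr. destruct (archimed r) as [h1 h2].
  assert (hz : (0 < up r)%Z) by (apply lt_IZR; lra).
  exists (Z.to_nat (up r - 1)). rewrite INR_IZR_INZ, Z2Nat.id by lia.
  rewrite minus_IZR. lra.
Qed.

Lemma nat_floor_half (r : R) : 1 <= r -> exists k : nat, INR k <= r < 2 * INR k.
Proof.
  intros hr. destruct (nat_floor r) as [k hk]; [lra|]. exists k.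
  assert (1 <= INR k); [|lra].
  destruct k; [simpl in hk; lra|]. rewrite S_INR. assert (h := pos_INR k). lra.
Qed.

Lemma square_le_reg (a b : R) : 0 <= b -> a ^ 2 <= b ^ 2 -> a <= b.
Proof. intros hb h. nra. Qed.

Definition power_saving (N n : nat) : Prop := INR n ^ 20 <= 10 ^ 80 * INR N ^ 19.

(** The first hypothesis has the shape of [solutions_bound], with n = |X|, q = p - 1 and u2, u6 the
    sizes of two windows. Up to constants the choice is t1 = n^2 / N, t0 = N / n, m^2 = n^3 / N and
    t2 = m^2 t1^2 n^2 / N, and the resulting inequality reads n^20 <= C N^19. *)
Lemma parameter_choice (n N q u2 u6 : nat) :
  (forall m t0 t1 t2 : nat,
    (2 < m -> m <= n -> t1 <= n -> 400 * (u2 * t1) <= n ^ 2 ->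
     0 < t0 -> 2 * S (2 * N / t0) < n ->
     32 * (u6 * t2) <= m ^ 2 * t1 ^ 2 * n ^ 2 ->
     32 * t0 * m ^ 2 * n ^ 2 <= t1 ^ 2 * q ->
     m ^ 2 * t1 ^ 4 * t2 <= 8 * u6 ^ 10)%nat) ->
  (1 <= N)%nat -> (N * N <= q)%nat -> (n <= 2 * N + 1)%nat ->
  (u2 <= 4 * N + 1)%nat -> (u6 <= 12 * N + 1)%nat ->
  power_saving N n.
Proof.
  intros H hN hq hn hu2 hu6. unfold power_saving.
  apply le_INR in hN, hq, hn, hu2, hu6.
  rewrite mult_INR in hq. rewrite plus_INR, mult_INR in hn, hu2, hu6.
  change (INR 1) with 1 in *. change (INR 2) with 2 in *.
  replace (INR 4) with 4 in hu2 by (simpl; lra).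
  replace (INR 12) with 12 in hu6 by (simpl; lra).
  set (x := INR n) in *. set (y := INR N) in *.
  assert (hx0 : 0 <= x) by apply pos_INR.
  assert (x3y : x <= 3 * y) by lra.
  destruct (Rle_or_lt (x ^ 20) (10 ^ 80 * y ^ 19)) as [h|h]; [exact h|exfalso].
  assert (ypow : forall k, (k <= 19)%nat -> 0 < y ^ k <= y ^ 19).
  { intros k hk. split; [apply pow_lt; lra|]. apply Rle_pow; [lra|lia]. }
  (* [hb] and [hc] keep the real values of t1 and m well above 1, so that rounding down costs at
     most a factor 2. *)
  assert (hb : 10 ^ 4 * y <= x ^ 2).
  { destruct (Rle_or_lt (10 ^ 4 * y) (x ^ 2)) as [k|k]; [exact k|exfalso].
    assert (e : (x ^ 2) ^ 10 <= (10 ^ 4 * y) ^ 10) by (apply pow_incr; split; [apply pow2_ge_0|lra]).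
    rewrite Rpow_mult_distr, <- !pow_mult in e. simpl Nat.mul in e.
    assert (h10 := ypow 10%nat ltac:(lia)).
    assert (10 ^ 40 * y ^ 10 <= 10 ^ 80 * y ^ 19); [|lra].
    apply Rmult_le_compat; lra. }
  assert (hc : 10 ^ 12 * y <= x ^ 3).
  { destruct (Rle_or_lt (10 ^ 12 * y) (x ^ 3)) as [k|k]; [exact k|exfalso].
    assert (e : (x ^ 3) ^ 6 <= (10 ^ 12 * y) ^ 6) by (apply pow_incr; split; [apply pow_le; lra|lra]).
    assert (e2 : x ^ 2 <= (3 * y) ^ 2) by (apply pow_incr; lra).
    assert (e3 : (x ^ 3) ^ 6 * x ^ 2 <= (10 ^ 12 * y) ^ 6 * (3 * y) ^ 2).
    { apply Rmult_le_compat; try assumption; [|apply pow2_ge_0].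
      apply pow_le, pow_le; lra. }
    replace ((x ^ 3) ^ 6 * x ^ 2) with (x ^ 20) in e3 by ring.
    replace ((10 ^ 12 * y) ^ 6 * (3 * y) ^ 2) with (9 * 10 ^ 72 * y ^ 8) in e3 by ring.
    assert (h8 := ypow 8%nat ltac:(lia)).
    assert (9 * 10 ^ 72 * y ^ 8 <= 10 ^ 80 * y ^ 19); [|lra].
    apply Rmult_le_compat; lra. }
  assert (hx : 100 <= x) by nra.
  assert (hx2 : 0 < x ^ 2) by nra.
  assert (hx3 : 0 < x ^ 3) by (apply pow_lt; lra).
  (* 2000 = 400 * 5, as u2 <= 5 N. *)
  destruct (nat_floor_half (x ^ 2 / (2000 * y))) as [t1 [ht1 ht1']].
  { apply (Rmult_le_reg_r (2000 * y)); [lra|]. unfold Rdiv. rewrite Rmult_assoc, Rinv_l; lra. }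
  assert (a1 : 2000 * y * INR t1 <= x ^ 2).
  { apply (Rmult_le_compat_l (2000 * y)) in ht1; [|lra].
    replace (2000 * y * (x ^ 2 / (2000 * y))) with (x ^ 2) in ht1 by (field; lra). lra. }
  assert (b1 : x ^ 2 < 4000 * y * INR t1).
  { apply (Rmult_lt_compat_l (2000 * y)) in ht1'; [|lra].
    replace (2000 * y * (x ^ 2 / (2000 * y))) with (x ^ 2) in ht1' by (field; lra). lra. }
  (* The [+ 1] forces t0 > 8 N / n, which makes the number of blocks of length t0 less than n /
     2. *)
  destruct (nat_floor (8 * y / x + 1)) as [t0 [ht0 ht0']].
  { assert (0 <= 8 * y / x) by (apply Rle_mult_inv_pos; lra). lra. }
  assert (a0 : 8 * y < x * INR t0).
  { assert (k : 8 * y / x < INR t0) by lra.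
    apply (Rmult_lt_compat_l x) in k; [|lra].
    replace (x * (8 * y / x)) with (8 * y) in k by (field; lra). lra. }
  assert (b0 : x * INR t0 <= 11 * y).
  { apply (Rmult_le_compat_l x) in ht0; [|lra].
    replace (x * (8 * y / x + 1)) with (8 * y + x) in ht0 by (field; lra). lra. }
  (* m will be the floor of the square root of this. With t0 <= 11 N / n and t1 > n^2 / (4000 N),
     the condition involving q holds because 10^10 exceeds 32 * 11 * 4000^2. *)
  assert (hr : 0 <= x ^ 3 / (10 ^ 10 * y)) by (apply Rle_mult_inv_pos; lra).
  assert (hr2 : sqrt (x ^ 3 / (10 ^ 10 * y)) ^ 2 * (10 ^ 10 * y) = x ^ 3).
  { rewrite pow2_sqrt by assumption. field; lra. }
  set (r := sqrt (x ^ 3 / (10 ^ 10 * y))) in *.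
  assert (hr0 : 0 <= r) by apply sqrt_pos.
  assert (hr10 : 10 <= r).
  { assert (k : 100 * (10 ^ 10 * y) <= r ^ 2 * (10 ^ 10 * y)) by (rewrite hr2; lra).
    apply Rmult_le_reg_r in k; [nra|lra]. }
  destruct (nat_floor r hr0) as [m [hm hm']].
  assert (am : INR m ^ 2 * (10 ^ 10 * y) <= x ^ 3).
  { rewrite <- hr2. apply Rmult_le_compat_r; [lra|]. apply pow_incr; split; [apply pos_INR|lra]. }
  assert (bm : x ^ 3 <= 4 * INR m ^ 2 * (10 ^ 10 * y)).
  { rewrite <- hr2. apply Rmult_le_compat_r; [lra|]. nra. }
  assert (m1 : 9 <= INR m) by lra.
  assert (t11 : 1 <= INR t1).
  { destruct t1; [simpl in b1; lra|]. rewrite S_INR. assert (k := pos_INR t1). lra. }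
  assert (hmt : 1 <= INR m ^ 2 * INR t1 ^ 2).
  { assert (1 <= INR m ^ 2) by nra. assert (1 <= INR t1 ^ 2) by nra. nra. }
  assert (hM : 416 * y <= INR m ^ 2 * INR t1 ^ 2 * x ^ 2) by nra.
  (* 416 = 32 * 13, as u6 <= 13 N. *)
  destruct (nat_floor_half (INR m ^ 2 * INR t1 ^ 2 * x ^ 2 / (416 * y))) as [t2 [ht2 ht2']].
  { apply (Rmult_le_reg_r (416 * y)); [lra|]. unfold Rdiv. rewrite Rmult_assoc, Rinv_l; lra. }
  assert (a2 : 416 * y * INR t2 <= INR m ^ 2 * INR t1 ^ 2 * x ^ 2).
  { apply (Rmult_le_compat_l (416 * y)) in ht2; [|lra].
    replace (416 * y * (INR m ^ 2 * INR t1 ^ 2 * x ^ 2 / (416 * y)))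
      with (INR m ^ 2 * INR t1 ^ 2 * x ^ 2) in ht2 by (field; lra). lra. }
  assert (b2 : INR m ^ 2 * INR t1 ^ 2 * x ^ 2 < 832 * y * INR t2).
  { apply (Rmult_lt_compat_l (416 * y)) in ht2'; [|lra].
    replace (416 * y * (INR m ^ 2 * INR t1 ^ 2 * x ^ 2 / (416 * y)))
      with (INR m ^ 2 * INR t1 ^ 2 * x ^ 2) in ht2' by (field; lra). lra. }
  assert (i32 : INR 32 = 32) by (rewrite INR_IZR_INZ; reflexivity).
  assert (i400 : INR 400 = 400) by (rewrite INR_IZR_INZ; reflexivity).
  assert (i8 : INR 8 = 8) by (rewrite INR_IZR_INZ; reflexivity).
  assert (c1 : (2 < m)%nat) by (apply INR_lt; simpl; lra).
  assert (c2 : (m <= n)%nat).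
  { apply INR_le. fold x. apply square_le_reg; [assumption|].
    apply (Rmult_le_reg_r (10 ^ 10 * y)); [lra|].
    assert (k : x ^ 2 * x <= x ^ 2 * (10 ^ 10 * y)) by (apply Rmult_le_compat_l; lra).
    replace (x ^ 2 * x) with (x ^ 3) in k by ring. lra. }
  assert (c3 : (t1 <= n)%nat).
  { apply INR_le. fold x. apply (Rmult_le_reg_l (2000 * y)); [lra|].
    assert (k : x * x <= 2000 * y * x) by (apply Rmult_le_compat_r; lra).
    replace (x * x) with (x ^ 2) in k by ring. lra. }
  assert (c4 : (400 * (u2 * t1) <= n ^ 2)%nat).
  { apply INR_le. rewrite !mult_INR, pow_INR, i400. fold x.
    assert (INR u2 * INR t1 <= 5 * y * INR t1) by (apply Rmult_le_compat_r; lra). lra. }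
  assert (c5 : (0 < t0)%nat).
  { destruct t0; [change (INR 0) with 0 in a0; rewrite Rmult_0_r in a0; lra|lia]. }
  assert (c6 : (2 * S (2 * N / t0) < n)%nat).
  { apply INR_lt. rewrite mult_INR, (S_INR (2 * N / t0)). fold x. change (INR 2) with 2.
    assert (hd : (t0 * (2 * N / t0) <= 2 * N)%nat) by (apply Nat.mul_div_le; lia).
    apply le_INR in hd. rewrite !mult_INR in hd. change (INR 2) with 2 in hd. fold y in hd.
    set (d := INR (2 * N / t0)) in *. assert (hd0 : 0 <= d) by apply pos_INR.
    assert (4 * d <= x); [|lra].
    assert (k : x * (INR t0 * d) <= x * (2 * y)) by (apply Rmult_le_compat_l; lra).
    assert (k2 : 8 * y * d <= x * INR t0 * d) by (apply Rmult_le_compat_r; lra).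
    apply (Rmult_le_reg_l (2 * y)); [lra|]. lra. }
  assert (c7 : (32 * (u6 * t2) <= m ^ 2 * t1 ^ 2 * n ^ 2)%nat).
  { apply INR_le. rewrite !mult_INR, !pow_INR, i32. fold x.
    assert (INR u6 * INR t2 <= 13 * y * INR t2)
      by (apply Rmult_le_compat_r; [apply pos_INR|lra]). lra. }
  assert (c8 : (32 * t0 * m ^ 2 * n ^ 2 <= t1 ^ 2 * q)%nat).
  { apply INR_le. rewrite !mult_INR, !pow_INR, i32. fold x.
    assert (k1 : x ^ 4 <= 16000000 * (INR t1 ^ 2 * (y * y))).
    { replace (x ^ 4) with (x ^ 2 * x ^ 2) by ring.
      replace (16000000 * (INR t1 ^ 2 * (y * y))) with ((4000 * y * INR t1) * (4000 * y * INR t1)) by ring.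
      apply Rmult_le_compat; lra. }
    assert (k2 : INR t1 ^ 2 * (y * y) <= INR t1 ^ 2 * INR q)
      by (apply Rmult_le_compat_l; [apply pow2_ge_0|lra]).
    assert (k3 : (x * INR t0) * (INR m ^ 2 * (10 ^ 10 * y)) <= (11 * y) * x ^ 3).
    { apply Rmult_le_compat; try assumption.
      - apply Rmult_le_pos; [lra|apply pos_INR].
      - apply Rmult_le_pos; [apply pow2_ge_0|lra]. }
    assert (k4 : INR t0 * INR m ^ 2 * 10 ^ 10 * x ^ 2 <= 11 * x ^ 4).
    { apply (Rmult_le_reg_l y); [lra|].
      replace (y * (INR t0 * INR m ^ 2 * 10 ^ 10 * x ^ 2))
        with (x * ((x * INR t0) * (INR m ^ 2 * (10 ^ 10 * y)))) by ring.
      replace (y * (11 * x ^ 4)) with (x * ((11 * y) * x ^ 3)) by ring.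
      apply Rmult_le_compat_l; lra. }
    assert (0 <= x ^ 4) by (apply pow_le; lra).
    lra. }
  assert (c9 := H m t0 t1 t2 c1 c2 c3 c4 c5 c6 c7 c8).
  apply le_INR in c9. rewrite !mult_INR, !pow_INR, i8 in c9.
  assert (U : INR u6 ^ 10 <= (13 * y) ^ 10) by (apply pow_incr; split; [apply pos_INR|lra]).
  set (M := INR m) in *. set (T := INR t1) in *.
  assert (T0 : 0 < T) by lra. assert (M0 : 0 < M) by lra.
  assert (d1 : M ^ 4 * T ^ 6 * x ^ 2 <= 832 * y * (8 * (13 * y) ^ 10)).
  { replace (M ^ 4 * T ^ 6 * x ^ 2) with (M ^ 2 * T ^ 4 * (M ^ 2 * T ^ 2 * x ^ 2)) by ring.
    assert (0 < M ^ 2 * T ^ 4) by (apply Rmult_lt_0_compat; apply pow_lt; lra).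
    apply Rle_trans with (M ^ 2 * T ^ 4 * (832 * y * INR t2)).
    - apply Rmult_le_compat_l; lra.
    - replace (M ^ 2 * T ^ 4 * (832 * y * INR t2)) with (832 * y * (M ^ 2 * T ^ 4 * INR t2)) by ring.
      apply Rmult_le_compat_l; lra. }
  assert (d2 : (x ^ 2) ^ 6 <= (4000 * y * T) ^ 6) by (apply pow_incr; lra).
  assert (d3 : (x ^ 3) ^ 2 <= (4 * M ^ 2 * (10 ^ 10 * y)) ^ 2) by (apply pow_incr; lra).
  assert (d4 : (x ^ 2) ^ 6 * (x ^ 3) ^ 2 * x ^ 2 <=
     (4000 * y * T) ^ 6 * (4 * M ^ 2 * (10 ^ 10 * y)) ^ 2 * x ^ 2).
  { apply Rmult_le_compat_r; [lra|]. apply Rmult_le_compat; try assumption; apply pow_le; lra. }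
  replace ((x ^ 2) ^ 6 * (x ^ 3) ^ 2 * x ^ 2) with (x ^ 20) in d4 by ring.
  replace ((4000 * y * T) ^ 6 * (4 * M ^ 2 * (10 ^ 10 * y)) ^ 2 * x ^ 2)
    with (4000 ^ 6 * 16 * 10 ^ 20 * y ^ 8 * (M ^ 4 * T ^ 6 * x ^ 2)) in d4 by ring.
  assert (y8 : 0 < y ^ 8) by (apply pow_lt; lra).
  assert (d5 : 4000 ^ 6 * 16 * 10 ^ 20 * y ^ 8 * (M ^ 4 * T ^ 6 * x ^ 2) <=
     4000 ^ 6 * 16 * 10 ^ 20 * y ^ 8 * (832 * y * (8 * (13 * y) ^ 10)))
    by (apply Rmult_le_compat_l; lra).
  replace (4000 ^ 6 * 16 * 10 ^ 20 * y ^ 8 * (832 * y * (8 * (13 * y) ^ 10)))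
    with (4000 ^ 6 * 16 * 10 ^ 20 * 832 * 8 * 13 ^ 10 * y ^ 19) in d5 by ring.
  assert (y19 : 0 < y ^ 19) by (apply pow_lt; lra).
  assert (4000 ^ 6 * 16 * 10 ^ 20 * 832 * 8 * 13 ^ 10 <= 10 ^ 80) by lra.
  assert (4000 ^ 6 * 16 * 10 ^ 20 * 832 * 8 * 13 ^ 10 * y ^ 19 <= 10 ^ 80 * y ^ 19)
    by (apply Rmult_le_compat_r; lra).
  lra.
Qed.

(** * Solutions of x - th y = 1 in geometric progressions *)

Module Combinatorics.

From mathcomp Require Import all_boot all_algebra.
From mathcomp Require Import ring zify.
Set Implicit Arguments.
Unset Strict Implicit.
Unset Printing Implicit Defensive.
Import GRing.Theory.
Local Open Scope nat_scope.

(** * Double counting and popular fibres *)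

Section Counting.
Variables T T' : finType.

Lemma card_dep (A : {set T}) (B : T -> {set T'}) :
  #|[set z : T * T' | (z.1 \in A) && (z.2 \in B z.1)]| = \sum_(a in A) #|B a|.
Proof.
rewrite -sum1_card; under [RHS]eq_bigr => a _ do rewrite -sum1_card.
by rewrite pair_big_dep /=; apply: eq_bigl => z; rewrite inE.
Qed.

Lemma card_dep_ge (A : {set T}) (B : T -> {set T'}) (K : nat) :
  (forall a, a \in A -> K <= #|B a|) ->
  #|A| * K <= #|[set z : T * T' | (z.1 \in A) && (z.2 \in B z.1)]|.
Proof. by move=> hK; rewrite card_dep -sum_nat_const; apply: leq_sum. Qed.

Lemma card_dep_le (A : {set T}) (B : T -> {set T'}) (K : nat) :
  (forall a, a \in A -> #|B a| <= K) ->
  #|[set z : T * T' | (z.1 \in A) && (z.2 \in B z.1)]| <= #|A| * K.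
Proof. by move=> hK; rewrite card_dep -sum_nat_const; apply: leq_sum. Qed.

Lemma card_markov (A : {set T}) (B : {set T'}) (P : T -> T' -> bool) (e : nat) :
  e * #|[set a in A | e <= #|[set b in B | P a b]| ]| <=
  #|[set z in setX A B | P z.1 z.2]|.
Proof.
rewrite mulnC; set A' := [set a in A | _].
apply: leq_trans (card_dep_ge (B := fun a => [set b in B | P a b]) (A := A') _) _.
  by move=> a; rewrite inE => /andP[_ ->].
apply: subset_leq_card; apply/subsetP => -[a b]; rewrite !inE /=.
by move=> /andP[/andP[-> _] /andP[-> ->]].
Qed.

(** Inside [G], a value in [R] with an unpopular point has a fibre of fewer than [t] points. All
    points outside [G] are given up. *)
Lemma card_unpopular (W G : {set T}) (psi : T -> T') (R : {set T'}) (t : nat) :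
  (forall w, w \in W -> psi w \in R) ->
  #|[set w in W | #|[set w' in W :&: G | psi w' == psi w]| < t]|
    <= #|R| * t + #|W :\: G|.
Proof.
move=> hR; set V := [set w in W | _].
have -> : #|V| = #|V :&: G| + #|V :\: G| by rewrite cardsID.
apply: leq_add; last first.
  by apply: subset_leq_card; apply: setSD; apply/subsetP => w; rewrite inE => /andP[].
rewrite -sum1_card (partition_big psi (fun h => h \in R)) /=; last first.
  by move=> w; rewrite !inE => /andP[/andP[/hR]].
rewrite -sum_nat_const; apply: leq_sum => h _.
rewrite sum1dep_card.
have [/existsP[w0 /andP[hw0 /eqP e0]]|] :=
    boolP [exists w, (w \in V) && (psi w == h)].
  move: hw0; rewrite inE e0 => /andP[_ /ltnW]; apply: leq_trans.
  apply: subset_leq_card; apply/subsetP => w; rewrite !inE.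
  by move=> /andP[/andP[/andP[-> _] ->] ->].
move/existsPn => hn; rewrite eq_card0 // => w; rewrite !inE.
apply/negP => /andP[/andP[h1 _] h2]; move: (hn w).
by rewrite h2 inE h1.
Qed.

End Counting.

(** * Subsets of prescribed size and no larger edge density *)

Section Sparse.
Variables (T : finType) (P : rel T).
Hypothesis Pirr : irreflexive P.

Definition edges (Z : {set T}) := \sum_(a in Z) \sum_(b in Z) P a b.

Lemma edges_card (Z : {set T}) : edges Z = #|[set w in setX Z Z | P w.1 w.2]|.
Proof.
rewrite /edges pair_big_dep /= -sum1_card.
rewrite big_mkcond /= [RHS]big_mkcond /=; apply: eq_bigr => -[a b] _ /=.
by rewrite !inE /=; case: (_ && _) => //=; case: (P a b).
Qed.

Lemma edges_setD1 (Z : {set T}) z : z \in Z ->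
  edges Z = edges (Z :\ z) + (\sum_(b in Z) P z b + \sum_(a in Z) P a z).
Proof.
move=> hz; have h (f : T -> nat) : \sum_(a in Z) f a = f z + \sum_(a in Z :\ z) f a.
  by rewrite (big_setD1 z hz).
rewrite /edges (h (fun a => \sum_(b in Z) P a b)) (h (fun a => P a z : nat)) Pirr.
have -> : \sum_(a in Z :\ z) \sum_(b in Z) P a b =
    \sum_(a in Z :\ z) P a z + \sum_(a in Z :\ z) \sum_(b in Z :\ z) P a b.
  rewrite -big_split /=; apply: eq_bigr => a _.
  by rewrite (h (fun b => P a b : nat)).
lia.
Qed.

(** An ordered pair survives the removal of z unless z is one of its two ends, so on average the
    factor is 1 - 2 / |Z|. The weaker factor (1 - 1 / |Z|)^2 telescopes under repeated removal. *)
Lemma sparse_step (Z : {set T}) : 0 < #|Z| ->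
  exists2 z, z \in Z & edges (Z :\ z) * #|Z| ^ 2 <= edges Z * (#|Z|.-1) ^ 2.
Proof.
move=> hZ.
have hsum : \sum_(z in Z) edges (Z :\ z) + 2 * edges Z = #|Z| * edges Z.
  have -> : 2 * edges Z =
     \sum_(z in Z) (\sum_(b in Z) P z b + \sum_(a in Z) P a z).
    rewrite big_split /= [X in _ = _ + X]exchange_big /= /edges; lia.
  rewrite -big_split /= -sum_nat_const; apply: eq_bigr => z hz.
  by rewrite (edges_setD1 hz).
have [/existsP[z /andP[hz h]]|/existsPn hn] :=
   boolP [exists z, (z \in Z) && (edges (Z :\ z) * #|Z| <= edges Z * (#|Z| - 2))].
  exists z => //.
  have h1 : edges (Z :\ z) * #|Z| * #|Z| <= edges Z * (#|Z| - 2) * #|Z|.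
    by rewrite leq_mul2r h orbT.
  apply: leq_trans (_ : edges Z * (#|Z| - 2) * #|Z| <= _); first by lia.
  rewrite -mulnA leq_mul2l; apply/orP; right; nia.
exfalso.
have : \sum_(z in Z) (edges Z * (#|Z| - 2)).+1 <= \sum_(z in Z) (edges (Z :\ z) * #|Z|).
  apply: leq_sum => z hz; move: (hn z); rewrite hz /=; lia.
rewrite sum_nat_const -big_distrl /= => h.
have [h2|h2] := leqP 2 #|Z|.
  have [k hk] : exists k, #|Z| = k + 2 by exists (#|Z| - 2); lia.
  move: h hsum; rewrite hk; nia.
have h3 : #|Z| = 1 by lia.
by move: h hsum; rewrite h3; nia.
Qed.

(** Takes the place of a random subset of size m. *)
Lemma sparse_subset (X : {set T}) m : m <= #|X| ->
  exists Z : {set T}, [/\ Z \subset X, #|Z| = m &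
    edges Z * #|X| ^ 2 <= edges X * m ^ 2].
Proof.
move=> hm; have [k hk] : exists k, #|X| = m + k by exists (#|X| - m); lia.
elim: k m {hm} hk => [|k IH] m hk.
  by exists X; rewrite hk addn0; split.
have [Z [ZX cZ hZ]] := IH m.+1 (ltac:(lia)).
have [z hz] := @sparse_step Z (ltac:(by rewrite cZ)).
rewrite cZ /= => hs; exists (Z :\ z); split.
- by apply: subset_trans ZX; apply: subD1set.
- by have := cardsD1 z Z; rewrite hz cZ; lia.
- have h1 : edges (Z :\ z) * m.+1 ^ 2 * #|X| ^ 2 <= edges X * m ^ 2 * m.+1 ^ 2.
    apply: leq_trans (_ : edges Z * m ^ 2 * #|X| ^ 2 <= _).
      by rewrite leq_mul2r hs orbT.
    have := leq_mul hZ (leqnn (m ^ 2)); lia.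
  have h2 : 0 < m.+1 ^ 2 by rewrite expn_gt0.
  rewrite -(leq_pmul2r h2); lia.
Qed.

End Sparse.

(** * Short intervals of powers of g *)

Section Window.
Variables (F : finFieldType) (g : F) (N : nat).
Hypothesis g0 : g != 0%R.

(* The powers g^a with |a| <= k N. *)
Definition window (k : nat) : {set F} :=
  [set z | [exists a : 'I_(2 * k * N).+1, z == g ^+ a / g ^+ (k * N)]%R].

Lemma windowP k z :
  reflect (exists2 a, a <= 2 * k * N & z = (g ^+ a / g ^+ (k * N))%R) (z \in window k).
Proof.
rewrite inE; apply: (iffP existsP) => [[a /eqP ->]|[a ha ->]].
  by exists a => //; rewrite -ltnS ltn_ord.
by exists (Ordinal (ltac:(by rewrite ltnS) : a < (2 * k * N).+1)); rewrite /= eqxx.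
Qed.

Lemma card_window k : #|window k| <= 2 * k * N + 1.
Proof.
pose f (a : 'I_(2 * k * N).+1) : F := (g ^+ a / g ^+ (k * N))%R.
have -> : window k = f @: [set: 'I_(2 * k * N).+1].
  apply/setP => z; rewrite inE; apply/existsP/imsetP => [[a /eqP ->]|[a _ ->]].
    by exists a.
  by exists a; rewrite eqxx.
by apply: leq_trans (leq_imset_card _ _) _; rewrite cardsT card_ord addn1.
Qed.

Lemma window_neq0 k z : z \in window k -> z != 0%R.
Proof.
by move=> /windowP[a _ ->]; rewrite mulf_neq0 ?invr_neq0 ?expf_neq0.
Qed.

Lemma windowM i j z w : z \in window i -> w \in window j -> (z * w)%R \in window (i + j).
Proof.
move=> /windowP[a ha ->] /windowP[b hb ->]; apply/windowP; exists (a + b).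
  by rewrite mulnDr mulnDl leq_add.
by rewrite mulnDl !exprD invfM mulrACA.
Qed.

Lemma windowV i z : z \in window i -> (z^-1)%R \in window i.
Proof.
move=> /windowP[a ha ->]; apply/windowP; exists (2 * i * N - a); first exact: leq_subr.
rewrite invf_div; apply/eqP; rewrite eqr_div ?expf_neq0 // -!exprD.
by apply/eqP; congr (_ ^+ _)%R; lia.
Qed.

Lemma window_leq i j z : i <= j -> z \in window i -> z \in window j.
Proof.
move=> ij /windowP[a ha ->]; apply/windowP; exists (a + (j - i) * N); first by nia.
apply/eqP; rewrite eqr_div ?expf_neq0 // -!exprD.
by apply/eqP; congr (_ ^+ _)%R; nia.
Qed.

End Window.

(** * Expanding a linear form into ten terms in many ways *)

Section Terms.
Variables (F : finFieldType) (g th : F) (N : nat).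
Hypotheses (g0 : g != 0%R) (th0 : th != 0%R).
Variables (X X' : {set F}).
Hypothesis X'X : X' \subset X.

(* X consists of solutions (x, y) of x = 1 + th * y, recorded by x; [yv x] is y. *)
Definition yv (x : F) : F := ((x - 1) / th)%R.

Hypothesis hX : forall x, x \in X -> x \in window g N 1.
Hypothesis hY : forall x, x \in X -> yv x \in window g N 1.

Definition tau (h : F) : nat := #|[set x in X | (h * x)%R \in X]|.

(* A point ((u, u'), ((e1, x1), (e2, x2))) of [quads] stands for the quotient
   [psi] = yv u * e2 * yv x2 / (yv u' * e1 * yv x1).  The same set provides both
   the data to be linked (u, u' then give the multiplier s = yv u / yv u') and
   the links themselves (e2, e1 then are the points y1, y2 at which the linear
   form is evaluated); this is what makes most data linkable. *)
Definition quads : {set (F * F) * ((F * F) * (F * F))} :=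
  setX (setX X X) (setX (setX X' X) (setX X' X)).

Definition psi (w : (F * F) * ((F * F) * (F * F))) : F :=
  (yv w.1.1 * (w.2.2.1 * yv w.2.2.2) / (yv w.1.2 * (w.2.1.1 * yv w.2.1.2)))%R.

(** [B] will hold the pairs (y1, y2) at which the linear form has a collision. In a link y1 is the
    second base point and y2 the first, whence the order of coordinates. *)
Definition outside (B : {set F * F}) : {set (F * F) * ((F * F) * (F * F))} :=
  [set w | (w.2.2.1, w.2.1.1) \notin B].

Definition links (B : {set F * F}) (w : (F * F) * ((F * F) * (F * F))) :=
  [set w' in quads :&: outside B | psi w' == psi w].

Let x0 x : x \in X -> x != 0%R.
Proof. by move/hX/(window_neq0 g0). Qed.
Let y0 x : x \in X -> yv x != 0%R.
Proof. by move/hY/(window_neq0 g0). Qed.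
Let yvE x : (th * yv x = x - 1)%R.
Proof. by rewrite /yv mulrC mulfVK. Qed.
Let yv_inj : injective yv.
Proof. by move=> x y /(congr1 (fun z => th * z)%R); rewrite !yvE => /addIr. Qed.

Section Fixed.
Variables (a b c d s5 s6 : F) (B : {set F * F}).
Hypotheses (aX : a \in X') (bX : b \in X') (cX : c \in X') (dX : d \in X').
Hypotheses (cd : c != d) (s5X : s5 \in X) (s6X : s6 \in X).
Let s := (yv s5 / yv s6)%R.
Let rho := (s * ((a - b) / (c - d)))%R.
Hypothesis rho_inj : forall u v u' v', u \in X' -> v \in X' -> u' \in X' -> v' \in X' ->
  (u, v) \notin B -> (u + rho * v = u' + rho * v')%R -> u = u' /\ v = v'.

(* With T1 = y1 e1 y(a1), T2 = s y2 e2 y(a4) and c x = e x' for x, x' in X one has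
   c - e = th (e y(x') - c y(x)); if T y(x) = T' y(x') then T - T' = T x - T' x'.
   Routing c -> e1 -> d and a -> e2 -> b through the first identity and replacing
   T1 - T2 by T1 - T + T - T2 through the second one expands
   (c - d) y1 + s (a - b) y2 into these ten terms, up to signs and the factor th. *)
Definition terms (o : ((F * F) * (F * F)) * (F * F) * ((F * F) * ((F * F) * (F * F)))) :
    F * F * F * F * F * F * F * F * F * F :=
  let: (((e1, a1), (e2, a4)), (z2, z3), ((xc, xd), ((y2, xb), (y1, xa)))) := o in
  let T1 := (y1 * e1 * yv a1)%R in
  let T2 := (s * y2 * e2 * yv a4)%R in
  let T := (T1 * yv xa / yv xb)%R in
  (y1 * c * yv (e1 / c * a1), y1 * d * yv (e1 / d * z2), y1 * e1 * yv z2,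
   s * y2 * e2 * yv z3, s * y2 * a * yv (e2 / a * z3), s * y2 * b * yv (e2 / b * a4),
   T1 * xa, T * xb, T * xc, T2 * xd)%R.

(** An element ((e1, a1), (e2, a4)) of Q carries the steps c -> e1 and e2 -> b of the two routes; z2
    and z3 carry e1 -> d and a -> e2, and the link joins T1 to T2. *)
Definition configs (Q : {set (F * F) * (F * F)}) :
    {set ((F * F) * (F * F)) * (F * F) * ((F * F) * ((F * F) * (F * F)))} :=
  [set o | (o.1 \in [set u | (u.1 \in Q) &&
     (u.2 \in setX [set z in X | u.1.1.1 / d * z \in X]%R
                   [set z in X | u.1.2.1 / a * z \in X]%R)]) &&
     (o.2 \in links B ((s5, s6), o.1.1))].

Definition admissible : {set (F * F) * (F * F)} :=
  [set q | [&& q.1.1 \in X', q.1.2 \in X, (q.1.1 / c * q.1.2)%R \in X,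
              q.2.1 \in X', q.2.2 \in X & (q.2.1 / b * q.2.2)%R \in X]].

Lemma configsP (Q : {set (F * F) * (F * F)}) e1 a1 e2 a4 z2 z3 xc xd y2 xb y1 xa :
  Q \subset admissible ->
  (((e1, a1), (e2, a4)), (z2, z3), ((xc, xd), ((y2, xb), (y1, xa)))) \in configs Q ->
  [/\ [/\ e1 \in X', a1 \in X, (e1 / c * a1)%R \in X, e2 \in X' & a4 \in X],
      [/\ (e2 / b * a4)%R \in X, z2 \in X, (e1 / d * z2)%R \in X, z3 \in X & (e2 / a * z3)%R \in X],
      [/\ xc \in X, xd \in X, y2 \in X', xb \in X & y1 \in X'] &
      [/\ xa \in X, (y1, y2) \notin B &
       (y1 * e1 * yv a1 * yv xa * yv xc = s * y2 * e2 * yv a4 * yv xb * yv xd)%R]].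
Proof.
move=> /subsetP QA; rewrite !inE /= => /and3P[/andP[/QA]].
rewrite !inE /= => /and5P[h1 h2 h3 h4 /andP[h5 h6]] /andP[/andP[h7 h8] /andP[h9 h10]].
move=> /andP[/andP[/andP[h11 h12] /andP[/andP[h13 h14] /andP[h15 h16]]] h17] /eqP.
have sub := subsetP X'X.
have n1 := x0 (sub _ h1); have n2 := x0 (sub _ h13).
have nz (u v w : F) : (u != 0 -> v != 0 -> w != 0 -> u * (v * w) != 0)%R.
  by move=> hu hv hw; apply: mulf_neq0 => //; apply: mulf_neq0.
have m1 := nz _ _ _ (y0 h12) n2 (y0 h14); have m2 := nz _ _ _ (y0 s6X) n1 (y0 h2).
rewrite /psi /= => /eqP; rewrite eqr_div // => /eqP e.
split; split => //; rewrite /s.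
have ns := y0 s6X; apply: (@mulfI _ (yv s6)) => //.
transitivity (yv xc * (y1 * yv xa) * (yv s6 * (e1 * yv a1)))%R; first by ring.
by rewrite e; field.
Qed.

(** The multiplier [s] costs 2 and every other factor or divisor 1. The total 6 is reached by
    [T * xb], [T * xc] and [T2 * xd]. *)
Lemma terms_window (Q : {set (F * F) * (F * F)}) o : Q \subset admissible -> o \in configs Q ->
  let U := window g N 6 in
  terms o \in setX (setX (setX (setX (setX (setX (setX (setX (setX U U) U) U) U) U) U) U) U) U.
Proof.
move=> QA; case: o => -[[[e1 a1] [e2 a4]] [z2 z3]] [[xc xd] [[y2 xb] [y1 xa]]].
move=> /(configsP QA)[[h1 h2 h3 h4 h5] [h6 h7 h8 h9 h10] [h11 h12 h13 h14 h15] [h16 h17 h18]].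
have sub := subsetP X'X.
have hX' x : x \in X' -> x \in window g N 1 by move/sub/hX.
have M i j := @windowM F g N i j; have V := windowV g0.
have hs : s \in window g N 2 by exact: (M 1 1 _ _ (hY s5X) (V _ _ _ (hY s6X))).
have w1 x z t : x \in X' -> z \in X' -> t \in X -> (x * z * yv t)%R \in window g N 3.
  by move=> hx hz ht; exact: (M 2 1 _ _ (M 1 1 _ _ (hX' _ hx) (hX' _ hz)) (hY ht)).
have w3 x z t : x \in X' -> z \in X' -> t \in X -> (s * x * z * yv t)%R \in window g N 5.
  move=> hx hz ht.
  exact: (M 4 1 _ _ (M 3 1 _ _ (M 2 1 _ _ hs (hX' _ hx)) (hX' _ hz)) (hY ht)).
have hT1 := w1 _ _ _ h15 h1 h2.
have hT : (y1 * e1 * yv a1 * yv xa / yv xb)%R \in window g N 5.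
  exact: (M 4 1 _ _ (M 3 1 _ _ hT1 (hY h16)) (V _ _ _ (hY h14))).
have U3 := window_leq g0 (isT : 3 <= 6); have U5 := window_leq g0 (isT : 5 <= 6).
rewrite /terms !in_setX U3 ?w1 // U3 ?w1 // U3 ?w1 // U5 ?w3 // U5 ?w3 // U5 ?w3 //=.
rewrite (window_leq g0 (isT : 4 <= 6) (M 3 1 _ _ hT1 (hX h16))).
rewrite (M 5 1 _ _ hT (hX h14)) (M 5 1 _ _ hT (hX h11)).
by rewrite (M 5 1 _ _ (w3 _ _ _ h13 h4 h5) (hX h12)).
Qed.

Definition altsum (t : F * F * F * F * F * F * F * F * F * F) : F :=
  let: (t1, t2, t3, t4, t5, t6, t7, t8, t9, t10) := t in
  (- t1 + t2 - t3 + t4 - t5 + t6 + t7 - t8 + t9 - t10)%R.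

Lemma terms_sum e1 a1 e2 a4 z2 z3 xc xd y2 xb y1 xa :
  c != 0%R -> d != 0%R -> a != 0%R -> b != 0%R -> yv xa != 0%R -> yv xb != 0%R ->
  yv xd != 0%R -> yv xc != 0%R ->
  (y1 * e1 * yv a1 * yv xa * yv xc = s * y2 * e2 * yv a4 * yv xb * yv xd)%R ->
  (th * altsum (terms (((e1, a1), (e2, a4)), (z2, z3), ((xc, xd), ((y2, xb), (y1, xa))))) =
    (c - d) * (y1 + rho * y2))%R.
Proof.
move=> c0 d0 a0 b0 xa0 xb0 xd0 xc0 e; rewrite /terms /altsum.
have cd0 : (c - d != 0)%R by rewrite subr_eq0.
have xE (x : F) : x = (1 + th * yv x)%R by rewrite yvE; ring.
have xaE := xE xa; have xbE := xE xb; have xcE := xE xc; have xdE := xE xd.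
have e' : (y1 * e1 * yv a1 * yv xa / yv xb * yv xc = s * y2 * e2 * yv a4 * yv xd)%R.
  apply: (@mulfI _ (yv xb)) => //.
  transitivity (y1 * e1 * yv a1 * yv xa * yv xc)%R; first by field.
  by rewrite e; ring.
set T1 := (y1 * e1 * yv a1)%R in e e' *.
set T2 := (s * y2 * e2 * yv a4)%R in e e' *.
set T := (T1 * yv xa / yv xb)%R in e' *.
have eT : (T * yv xb = T1 * yv xa)%R by rewrite /T mulfVK.
(* After x = 1 + th y the constant parts telescope. The parts with [th] cancel, by the definition of
   [T] and by the link equation. *)
have l1 : (T1 * xa - T * xb + T * xc - T2 * xd = T1 - T2)%R.
  rewrite xaE xbE xcE xdE.
  transitivity (T1 - T2 + th * (T1 * yv xa - T * yv xb) + th * (T * yv xc - T2 * yv xd))%R.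
    by ring.
  by rewrite eT e'; ring.
transitivity (th * (- (y1 * c * yv (e1 / c * a1)) + y1 * d * yv (e1 / d * z2) - y1 * e1 * yv z2
   + s * y2 * e2 * yv z3 - s * y2 * a * yv (e2 / a * z3) + s * y2 * b * yv (e2 / b * a4)
   + (T1 * xa - T * xb + T * xc - T2 * xd)))%R; first by ring.
rewrite l1 /T1 /T2 /rho /yv; field.
by rewrite c0 d0 a0 b0 cd0 th0.
Qed.

(* The alternating sum recovers y1 + rho y2, hence (y1, y2); the remaining
   parameters are then read off one by one. *)
Lemma terms_inj (Q : {set (F * F) * (F * F)}) : Q \subset admissible -> {in configs Q &, injective terms}.
Proof.
move=> QA [[[[e1 a1] [e2 a4]] [z2 z3]] [[xc xd] [[y2 xb] [y1 xa]]]].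
move=> [[[[f1 b1] [f2 b4]] [u2 u3]] [[vc vd] [[v2 vb] [v1 va]]]].
move=> /(configsP QA)[[h1 h2 h3 h4 h5] [h6 h7 h8 h9 h10] [h11 h12 h13 h14 h15] [h16 h17 h18]].
move=> /(configsP QA)[[k1 k2 k3 k4 k5] [k6 k7 k8 k9 k10] [k11 k12 k13 k14 k15] [k16 k17 k18]].
have sub := subsetP X'X.
have nz x : x \in X' -> x != 0%R by move/sub/x0.
have c0 := nz _ cX; have d0 := nz _ dX; have a0 := nz _ aX; have b0 := nz _ bX.
have s0 : s != 0%R by apply: mulf_neq0; [|apply: invr_neq0]; apply: y0.
have E1 := terms_sum z2 z3 c0 d0 a0 b0 (y0 h16) (y0 h14) (y0 h12) (y0 h11) h18.
have E2 := terms_sum u2 u3 c0 d0 a0 b0 (y0 k16) (y0 k14) (y0 k12) (y0 k11) k18.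
move=> et; rewrite et in E1.
have cd0 : (c - d != 0)%R by rewrite subr_eq0.
have [ey1 ey2] : y1 = v1 /\ y2 = v2.
  apply: rho_inj => //; apply: (@mulfI _ (c - d)%R cd0).
  by rewrite -E2 -E1.
subst v1 v2; clear E1 E2.
have n1 := nz _ h15; have n2 := nz _ h13.
move: et; rewrite /terms => -[t1 t2 t3 t4 t5 t6 t7 t8 t9 t10].
have can (u v w : F) (u0 : u != 0%R) : (u * v = u * w -> v = w)%R by apply: mulfI.
have p1 : (e1 * a1 = f1 * b1)%R.
  have := can _ _ _ (mulf_neq0 n1 c0) t1; move/yv_inj.
  by rewrite -!mulrA ![(c^-1 * _)%R]mulrC !mulrA => /(mulIf (invr_neq0 c0)).
have p2 : (e1 * z2 = f1 * u2)%R.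
  have := can _ _ _ (mulf_neq0 n1 d0) t2; move/yv_inj.
  by rewrite -!mulrA ![(d^-1 * _)%R]mulrC !mulrA => /(mulIf (invr_neq0 d0)).
have p5 : (e2 * z3 = f2 * u3)%R.
  have := can _ _ _ (mulf_neq0 (mulf_neq0 s0 n2) a0) t5; move/yv_inj.
  by rewrite -!mulrA ![(a^-1 * _)%R]mulrC !mulrA => /(mulIf (invr_neq0 a0)).
have p6 : (e2 * a4 = f2 * b4)%R.
  have := can _ _ _ (mulf_neq0 (mulf_neq0 s0 n2) b0) t6; move/yv_inj.
  by rewrite -!mulrA ![(b^-1 * _)%R]mulrC !mulrA => /(mulIf (invr_neq0 b0)).
(* Subtract [th] times the second equation from the first, using z - th y(z) = 1. *)
have eq1 (x z u v : F) : (x * z = u * v -> x * yv z = u * yv v -> x = u)%R.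
  move=> q1 q2; have : (x * (1 + th * yv z) = u * (1 + th * yv v))%R.
    by rewrite !yvE !(addrC 1%R) !subrK.
  rewrite !mulrDr !mulr1 ![(_ * (th * _))%R]mulrCA q2.
  by move/addIr.
have q1 : e1 = f1.
  apply: (eq1 _ _ _ _ p2); apply: (can _ _ _ n1); by rewrite mulrA t3 -mulrA.
have q2 : e2 = f2.
  apply: (eq1 _ _ _ _ p5); apply: (can _ _ _ (mulf_neq0 s0 n2)); by rewrite mulrA t4 -mulrA.
subst f1 f2.
have m1 := nz _ h1; have m2 := nz _ h4.
move/(can _ _ _ m1): p1 => p1; move/(can _ _ _ m1): p2 => p2.
move/(can _ _ _ m2): p5 => p5; move/(can _ _ _ m2): p6 => p6.
subst b1 u2 u3 b4.
have T10 : (y1 * e1 * yv a1 != 0)%R.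
  by apply: mulf_neq0; [apply: mulf_neq0|apply: y0].
have T20 : (s * y2 * e2 * yv a4 != 0)%R.
  by apply: mulf_neq0; [do 2?[apply: mulf_neq0 => //]|apply: y0].
move/(can _ _ _ T10): t7 => p7; move/(can _ _ _ T20): t10 => p10; subst va vd.
(* The eighth term determines xb / y(xb), and x / (x - 1) is injective in x. *)
have pb : xb = vb.
  have := y0 h14; have := y0 k14 => nb1 nb2.
  have T0 := mulf_neq0 T10 (y0 h16); move: t8; set D := (_ * yv xa)%R in T0 *.
  move=> t8; have : (yv vb * xb = yv xb * vb)%R.
    apply: (can _ _ _ T0).
    transitivity (yv vb * yv xb * (D / yv xb * xb))%R; first by field.
    by rewrite t8; field.
  move/(congr1 (fun z => th * z)%R).
  have yvM (x z : F) : (th * (yv x * z) = (x - 1) * z)%R by rewrite mulrA yvE.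
  rewrite !yvM => hh.
  have : ((vb - 1) * xb - (xb - 1) * vb = 0)%R by rewrite hh subrr.
  have -> : ((vb - 1) * xb - (xb - 1) * vb = vb - xb)%R by ring.
  by move/eqP; rewrite subr_eq0 => /eqP.
subst vb.
have pc : xc = vc.
  apply: (can _ _ _ _ t9); apply: mulf_neq0; last by apply: invr_neq0; apply: y0.
  by apply: mulf_neq0 => //; apply: y0.
by subst vc.
Qed.

(** Each element of Q extends by at least t1 choices of z2, t1 of z3 and t2 links, and [terms]
    embeds all these configurations into a tenfold product of the window. *)
Lemma config_count (Q : {set (F * F) * (F * F)}) t1 t2 : Q \subset admissible ->
  (forall q, q \in Q -> t1 <= tau (q.1.1 / d)%R) ->
  (forall q, q \in Q -> t1 <= tau (q.2.1 / a)%R) ->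
  (forall q, q \in Q -> t2 <= #|links B ((s5, s6), q)|) ->
  #|Q| * (t1 * t1) * t2 <= #|window g N 6| ^ 10.
Proof.
move=> QA H1 H2 H3.
apply: (@leq_trans #|configs Q|).
  pose Z (q : (F * F) * (F * F)) := setX [set z in X | q.1.1 / d * z \in X]%R
                                         [set z in X | q.2.1 / a * z \in X]%R.
  have hZ : #|Q| * (t1 * t1) <= #|[set u : _ * (F * F) | (u.1 \in Q) && (u.2 \in Z u.1)]|.
    by apply: card_dep_ge => q hq; rewrite cardsX leq_mul ?H1 ?H2.
  apply: leq_trans (leq_mul hZ (leqnn t2)) _.
  apply: (card_dep_ge (B := fun u => links B ((s5, s6), u.1))) => u.
  by rewrite inE => /andP[/H3].
rewrite -(card_in_imset (terms_inj QA)).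
set U := window g N 6.
apply: (@leq_trans #|setX (setX (setX (setX (setX (setX (setX (setX (setX U U) U) U) U) U) U) U) U) U|).
  apply: subset_leq_card; apply/subsetP => _ /imsetP[o ho ->].
  exact: terms_window ho.
by rewrite !cardsX; rewrite !expnS expn0 muln1 !mulnA.
Qed.

End Fixed.
End Terms.

(** * Multipliers preserving the set of difference quotients *)

Section Pivot.
Variables (F : finFieldType) (g th : F) (N : nat).
Hypotheses (g0 : g != 0%R) (th0 : th != 0%R).
Hypothesis g_gen : forall z : F, z != 0%R -> exists i, z = (g ^+ i)%R.
Variables (X X' : {set F}).
Hypothesis X'X : X' \subset X.
Hypothesis hX : forall x, x \in X -> x \in window g N 1.
Hypothesis hY : forall x, x \in X -> yv th x \in window g N 1.
Variables m t0 t1 t2 : nat.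
Let n := #|X|.
Let u6 := #|window g N 6|.
Hypothesis X'm : #|X'| <= m.
Hypothesis X'2 : 1 < #|X'|.
Hypothesis mids : forall c d, c \in X' -> d \in X' ->
  m <= 2 * #|[set e in X' | (t1 <= tau X (e / c)%R) && (t1 <= tau X (e / d)%R)]|.
Hypothesis C0 : 0 < t0.
Hypothesis C1 : 2 * (2 * N %/ t0).+1 < n.
Hypothesis C2 : 32 * (u6 * t2) <= m ^ 2 * t1 ^ 2 * n ^ 2.
Hypothesis C3 : 32 * t0 * m ^ 2 * n ^ 2 <= t1 ^ 2 * #|F|.-1.

Definition ratios : {set F} :=
  [set r | [exists q : (F * F) * (F * F), (q \in setX (setX X' X') (setX X' X')) &&
    [&& q.1.1 != q.1.2, q.2.1 != q.2.2 & r == (q.1.1 - q.1.2) / (q.2.1 - q.2.2)]]%R].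

Definition collisions (rho : F) : {set (F * F) * (F * F)} :=
  [set w in setX (setX X' X') (setX X' X') |
    (w.1 != w.2) && (w.1.1 + rho * w.1.2 == w.2.1 + rho * w.2.2)%R].

Definition badq (B : {set F * F}) (s : F * F) : {set (F * F) * (F * F)} :=
  [set q in setX (setX X' X) (setX X' X) | #|links th X X' B (s, q)| < t2].

(** The threshold is half of m^2 t1^2 / 4, the number of admissible data guaranteed in
    [typical_ratio]. *)
Definition typical (B : {set F * F}) : {set F * F} :=
  [set s in setX X X | 8 * #|badq B s| <= m ^ 2 * t1 ^ 2].

Lemma ratiosP r : reflect (exists a b c d, [/\ [/\ a \in X', b \in X', c \in X' & d \in X'],
   a != b, c != d & r = ((a - b) / (c - d))%R]) (r \in ratios).
Proof.
rewrite inE; apply: (iffP existsP).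
  move=> [[[a b] [c d]]]; rewrite !inE /=.
  move=> /andP[/andP[/andP[ha hb] /andP[hc hd]] /and3P[ab cd /eqP ->]].
  by exists a, b, c, d.
move=> [a [b [c [d [[ha hb hc hd] ab cd ->]]]]]; exists ((a, b), (c, d)).
by rewrite !inE /= ha hb hc hd ab cd eqxx.
Qed.

Lemma ratios_neq0 r : r \in ratios -> r != 0%R.
Proof.
move=> /ratiosP[a [b [c [d [_ ab cd ->]]]]].
by rewrite mulf_neq0 ?invr_neq0 ?subr_eq0.
Qed.

Lemma ratios1 : 1%R \in ratios.
Proof.
have /card_gt1P[a [b [ha hb ab]]] := X'2.
apply/ratiosP; exists a, b, a, b; split => //.
by rewrite divff ?subr_eq0.
Qed.

Let s0 s : s \in setX X X -> (yv th s.1 / yv th s.2)%R != 0%R.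
Proof.
rewrite inE => /andP[h1 h2]; apply: mulf_neq0; [|apply: invr_neq0].
  by have := window_neq0 g0 (hY h1).
by have := window_neq0 g0 (hY h2).
Qed.

Lemma card_admissible c d : c \in X' -> d \in X' ->
  m * t1 <= 2 * #|[set z : F * F |
     (z.1 \in [set e in X' | (t1 <= tau X (e / c)%R) && (t1 <= tau X (e / d)%R)]) &&
     (z.2 \in [set x in X | (z.1 / c * x)%R \in X])]|.
Proof.
move=> hc hd; set E := [set e in X' | _].
apply: leq_trans (leq_mul (mids hc hd) (leqnn t1)) _.
rewrite -mulnA leq_mul2l /=.
apply: (card_dep_ge (B := fun e => [set x in X | (e / c * x)%R \in X])) => e.
by rewrite inE => /andP[_ /andP[]].
Qed.

(** If rho = s (a - b) / (c - d), then [config_count] applies to the admissible data that are not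
    bad for s. At least m^2 t1^2 / 8 of them remain, too many for the first hypothesis. *)
Lemma typical_ratio (B : {set F * F}) rho s :
  8 * u6 ^ 10 < m ^ 2 * t1 ^ 4 * t2 ->
  (forall u v u' v', u \in X' -> v \in X' -> u' \in X' -> v' \in X' ->
     (u, v) \notin B -> (u + rho * v = u' + rho * v')%R -> u = u' /\ v = v') ->
  s \in typical B -> (rho / (yv th s.1 / yv th s.2))%R \notin ratios.
Proof.
move=> big uniq; case: s => s5 s6 hs; have := hs; rewrite inE => /andP[hsX hbad].
have := s0 hsX; move: hsX; rewrite inE /= => /andP[h5 h6] sn.
apply/negP => /ratiosP[a [b [c [d [[ha hb hc hd] ab cd erho]]]]].
have rhoE : rho = (yv th s5 / yv th s6 * ((a - b) / (c - d)))%R.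
  by rewrite -erho [RHS]mulrC divfK.
pose Q1 := [set z : F * F |
     (z.1 \in [set e in X' | (t1 <= tau X (e / c)%R) && (t1 <= tau X (e / d)%R)]) &&
     (z.2 \in [set x in X | (z.1 / c * x)%R \in X])].
pose Q2 := [set z : F * F |
     (z.1 \in [set e in X' | (t1 <= tau X (e / b)%R) && (t1 <= tau X (e / a)%R)]) &&
     (z.2 \in [set x in X | (z.1 / b * x)%R \in X])].
have c1 : m * t1 <= 2 * #|Q1| by apply: card_admissible.
have c2 : m * t1 <= 2 * #|Q2| by apply: card_admissible.
pose Q := setX Q1 Q2 :\: badq B (s5, s6).
have cQ : m ^ 2 * t1 ^ 2 <= 8 * #|Q|.
  have h1 : #|setX Q1 Q2| <= #|Q| + #|badq B (s5, s6)|.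
    rewrite -(cardsID (badq B (s5, s6)) (setX Q1 Q2)) addnC leq_add2l.
    by apply: subset_leq_card; apply: subsetIr.
  move: h1; rewrite cardsX => h1.
  have := leq_mul c1 c2.
  have -> : m * t1 * (m * t1) = m ^ 2 * t1 ^ 2 by ring.
  have -> : 2 * #|Q1| * (2 * #|Q2|) = 4 * (#|Q1| * #|Q2|) by ring.
  by move: hbad h1 => /=; clear; lia.
have QA : Q \subset admissible X X' b c.
  apply/subsetP => -[[e1 a1] [e2 a4]]; rewrite !inE /= => /andP[_].
  move=> /andP[/andP[/andP[-> _] /andP[-> ->]] /andP[/andP[-> _] /andP[-> ->]]] //.
have := @config_count F g th N g0 th0 X X' X'X hX hY a b c d s5 s6 B
  ha hb hc hd cd h5 h6 _ Q t1 t2 QA _ _ _.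
move=> H; have {H} : #|Q| * (t1 * t1) * t2 <= u6 ^ 10.
  apply: H.
  - by rewrite -rhoE.
  - move=> [[e1 a1] [e2 a4]]; rewrite !inE /= => /andP[_].
    by move=> /andP[/andP[/andP[_ /andP[_ ->]] _] _].
  - move=> [[e1 a1] [e2 a4]]; rewrite !inE /= => /andP[_].
    by move=> /andP[_ /andP[/andP[_ /andP[_ ->]] _]].
  - move=> [[e1 a1] [e2 a4]] hq; move: (hq); rewrite /Q in_setD => /andP[hn hq'].
    have : ((e1, a1), (e2, a4)) \in setX (setX X' X) (setX X' X).
      move: hq'; rewrite !inE /= => /andP[/andP[/andP[-> _] /andP[-> _]]].
      by move=> /andP[/andP[-> _] /andP[-> _]].
    by move=> hq2; move: hn; rewrite inE hq2 /= -leqNgt.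
move=> h; move: big; apply/negP; rewrite -leqNgt.
have := leq_mul cQ (leqnn (t1 ^ 2 * t2)); move: h.
have -> : m ^ 2 * t1 ^ 4 * t2 = m ^ 2 * t1 ^ 2 * (t1 ^ 2 * t2) by ring.
have -> : 8 * #|Q| * (t1 ^ 2 * t2) = 8 * (#|Q| * (t1 * t1) * t2) by ring.
move=> h1 h2; apply: leq_trans h2 _; by rewrite leq_mul2l h1.
Qed.

Lemma card_outside (B : {set F * F}) : #|quads X X' :\: outside B| <= #|B| * n ^ 4.
Proof.
pose f (w : (F * F) * ((F * F) * (F * F))) :=
  ((w.2.2.1, w.2.1.1), (w.1.1, w.1.2, w.2.1.2, w.2.2.2)).
have fi : injective f.
  by move=> [[a b] [[c d] [e h]]] [[a' b'] [[c' d'] [e' h']]] /= [-> -> -> -> -> ->].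
rewrite -(card_imset _ fi).
apply: (@leq_trans #|setX B (setX (setX (setX X X) X) X)|).
  apply: subset_leq_card; apply/subsetP => _ /imsetP[[[a b] [[c d] [e h]]] hw ->].
  move: hw; rewrite !inE /= negbK => /andP[-> /andP[/andP[-> ->] /andP[/andP[_ ->] /andP[_ ->]]]].
  by [].
by rewrite !cardsX leq_mul2l (_ : n ^ 4 = n * n * n * n) ?leqnn ?orbT //; ring.
Qed.

(** As [psi] maps into [window g N 6], at most u6 t2 + |B| n^4 <= m^2 t1^2 n^2 / 16 points have few
    links, half of this coming from [C2] and half from the bound on |B|. By Markov at most n^2 / 2
    pairs are atypical. *)
Lemma card_typical (B : {set F * F}) : 0 < m ^ 2 * t1 ^ 2 ->
  32 * (#|B| * n ^ 4) <= m ^ 2 * t1 ^ 2 * n ^ 2 ->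
  n ^ 2 <= 2 * #|typical B|.
Proof.
move=> pos hB.
set K := m ^ 2 * t1 ^ 2 in pos hB *.
(* The least integer above K / 8: having at least [e] bad data is the negation of being typical. *)
pose e := (K %/ 8).+1.
have tot : #|[set w in quads X X' | #|links th X X' B w| < t2]| <= u6 * t2 + #|B| * n ^ 4.
  apply: leq_trans (leq_add (leqnn _) (card_outside B)).
  apply: (@card_unpopular _ _ _ _ _ (window g N 6)) => -[[a b] [[c d] [e' h]]].
  rewrite !in_setX => /andP[/andP[ha hb] /andP[/andP[hc hd] /andP[he hh]]].
  have sub := subsetP X'X.
  have M i j := @windowM F g N i j; have V := windowV g0.
  rewrite /psi /=.
  have h1 := M 1 2 _ _ (hY ha) (M 1 1 _ _ (hX (sub _ he)) (hY hh)).
  have h2 := M 1 2 _ _ (hY hb) (M 1 1 _ _ (hX (sub _ hc)) (hY hd)).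
  exact: (M 3 3 _ _ h1 (V _ _ _ h2)).
have mk := card_markov (setX X X) (setX (setX X' X) (setX X' X))
   (fun s q => #|links th X X' B (s, q)| < t2) e.
have {mk} mk : e * #|[set s in setX X X | e <= #|badq B s|]| <= u6 * t2 + #|B| * n ^ 4.
  apply: leq_trans mk _; apply: leq_trans tot; apply: subset_leq_card.
  by apply/subsetP => -[s q]; rewrite !inE.
have cT : n ^ 2 = #|typical B| + #|[set s in setX X X | e <= #|badq B s|]|.
  have -> : n ^ 2 = #|setX X X| by rewrite cardsX mulnn.
  rewrite -(cardsID (typical B) (setX X X)); congr (_ + _).
    by congr #|pred_of_set _|; apply/setIidPr/subsetP => s; rewrite inE => /andP[].
  apply: eq_card => s; rewrite in_setD [in LHS]inE [in RHS]inE.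
  by case: (s \in setX X X); rewrite ?andbF //= andbT -/K /e; clear; lia.
have eK : K < 8 * e by rewrite /e; clear; lia.
have [//|lt] := leqP (n ^ 2) (2 * #|typical B|).
move: mk cT lt eK hB C2 pos; rewrite -/K.
move: #|typical B| #|[set s in _ | _]| => x y.
move: (n ^ 2) (u6 * t2) (#|B| * n ^ 4); move: e => e'; move: K => K'; clear; nia.
Qed.

(** Hence distinct nonzero multipliers have disjoint collision sets, and a nonzero multiplier
    outside [ratios] has no collisions. *)
Lemma collisions_ratio rho w : w \in collisions rho -> rho != 0%R ->
  rho = ((w.1.1 - w.2.1) / (w.2.2 - w.1.2))%R /\ rho \in ratios.
Proof.
case: w => -[u v] [u' v']; rewrite inE !in_setX /= => /andP[/andP[/andP[hu hv] /andP[hu' hv']]].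
move=> /andP[neq /eqP e] r0.
have vv : v' != v.
  apply: contraNneq neq => ev; move: e; rewrite ev => /addIr ->.
  by rewrite eqxx.
have e' : (rho * (v' - v) = u - u')%R.
  have -> : u = (u' + rho * v' - rho * v)%R by rewrite -e addrK.
  by ring.
have rE : rho = ((u - u') / (v' - v))%R by rewrite -e' mulfK // subr_eq0.
split; first exact: rE.
apply/ratiosP; exists u, u', v', v; split => //.
by apply: contraNneq r0 => eu; rewrite rE eu subrr mul0r.
Qed.

(* If the bound fails, [ratios] is stable under all typical multipliers, hence
   under some g^t with t < t0, so it fills a proportion 1/t of the nonzero
   elements and contains some r0 with few collisions; but r0 divided by a
   multiplier typical for r0 is then both inside and outside [ratios]. *)
Lemma pivot_bound : m ^ 2 * t1 ^ 4 * t2 <= 8 * u6 ^ 10.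
Proof.
rewrite leqNgt; apply/negP => big.
have pos : 0 < m ^ 2 * t1 ^ 2.
  by rewrite lt0n; apply/eqP => z; move: big; rewrite (_ : 4 = 2 + 2) // expnD mulnA z.
have n0 : 0 < n by apply: leq_trans C1.
(* Outside [ratios] the product would have no collisions, and [typical_ratio] with an empty
   exceptional set would put r itself outside [ratios]. *)
have closed s r : s \in typical set0 -> r \in ratios ->
    (r * (yv th s.1 / yv th s.2))%R \in ratios.
  move=> hs hr; apply/negPn/negP => hn.
  have hsX : s \in setX X X by move: hs; rewrite inE => /andP[].
  have sn := s0 hsX.
  have rn : (r * (yv th s.1 / yv th s.2) != 0)%R by rewrite mulf_neq0 // ratios_neq0.
  have := @typical_ratio set0 _ s big _ hs => H.
  have {H} := H (r * (yv th s.1 / yv th s.2))%R; rewrite mulfK // hr => H; apply/notF/H.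
  move=> u v u' v' hu hv hu' hv' _ e.
  have [|neq] := eqVneq (u, v) (u', v'); first by case.
  case/negP: hn; have := @collisions_ratio _ ((u, v), (u', v')) _ rn; case => //.
  by rewrite !inE /= hu hv hu' hv' neq /= e eqxx.
(* An injective map of the finite set [ratios] into itself is onto. *)
have closedV s r : s \in typical set0 -> r \in ratios ->
    (r / (yv th s.1 / yv th s.2))%R \in ratios.
  move=> hs hr.
  have hsX : s \in setX X X by move: hs; rewrite inE => /andP[].
  have sn := s0 hsX.
  have inj : injective (fun r : F => r * (yv th s.1 / yv th s.2))%R by apply: mulIf.
  have eR : [set (r * (yv th s.1 / yv th s.2))%R | r in ratios] = ratios.
    apply/eqP; rewrite eqEcard card_imset // leqnn andbT.
    by apply/subsetP => _ /imsetP[x hx ->]; apply: closed.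
  by move: hr; rewrite -{1}eR => /imsetP[x hx ->]; rewrite mulfK.
have T0 : n ^ 2 <= 2 * #|typical set0| by apply: card_typical => //; rewrite cards0.
(* A common denominator s6, by averaging; it cancels in the quotient of two multipliers. *)
have [s6 /andP[h6 hE]] : exists s6, (s6 \in X) && (n <= 2 * #|[set s5 in X | (s5, s6) \in typical set0]|).
  apply/existsP; apply: contraLR T0; rewrite negb_exists => /forallP hall.
  rewrite -ltnNge.
  have -> : #|typical set0| = \sum_(s6 in X) #|[set s5 in X | (s5, s6) \in typical set0]|.
    under eq_bigr => s _ do rewrite -sum1_card.
    rewrite (exchange_big_dep (fun s5 => s5 \in X)) /=; last by move=> i j _; rewrite inE => /andP[].
    rewrite pair_big_dep /= sum1dep_card; apply: eq_card => -[s5 s6]; rewrite !inE /=.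
    by case: (s5 \in X); case: (s6 \in X).
  rewrite big_distrr /=.
  have : \sum_(s6 in X) (2 * #|[set s5 in X | (s5, s6) \in typical set0]|).+1 <= \sum_(s6 in X) n.
    by apply: leq_sum => s hs; move: (hall s); rewrite hs /= -ltnNge.
  rewrite sum_nat_const -/n mulnn; under eq_bigr => s _ do rewrite -addn1.
  rewrite big_split /= sum_nat_const muln1 -/n; move: n0; clear; lia.
set E := [set s5 in X | _] in hE.
have [t [tpos tt0 tcl]] : exists t, [/\ 0 < t, t < t0 &
    forall r, r \in ratios -> (g ^+ t * r)%R \in ratios].
  (* The exponent of [yv th x], shifted by N. By [exE] the default value never matters on X. *)
  pose ex (x : F) : 'I_(2 * 1 * N).+1 :=
    odflt ord0 [pick a : 'I_(2 * 1 * N).+1 | (yv th x == g ^+ a / g ^+ (1 * N))%R].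
  have exE x : x \in X -> yv th x = (g ^+ ex x / g ^+ (1 * N))%R.
    move=> hx; rewrite /ex; case: pickP => [a /eqP //|no].
    have /windowP[a ha e] := hY hx.
    have ha' : a < (2 * 1 * N).+1 by [].
    by move: (no (Ordinal ha')); rewrite /= e eqxx.
  (* By [C1] there are fewer blocks of length t0 than points in E, so two points share a block and
     their exponents differ by less than t0. *)
  have blk_lt x : ex x %/ t0 < (2 * N %/ t0).+1.
    by rewrite ltnS leq_div2r // -ltnS -{2}(muln1 2) ltn_ord.
  pose blk x : 'I_(2 * N %/ t0).+1 := Ordinal (blk_lt x).
  have /dinjectivePn[x xE [x' x'E]] : ~~ dinjectiveb blk (mem E).
    apply/negP => /dinjectiveP inj.
    have := max_card [set blk x | x in E]; rewrite (card_in_imset inj) card_ord.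
    by move: hE C1; move: #|E| (_ %/ _) n; clear; lia.
  move=> /(congr1 val) /= eb.
  have key z z' : z \in E -> z' \in E -> ex z < ex z' -> ex z %/ t0 = ex z' %/ t0 ->
    exists t, [/\ 0 < t, t < t0 & forall r, r \in ratios -> (g ^+ t * r)%R \in ratios].
    move=> zE z'E lt e; exists (ex z' - ex z); split; first by rewrite subn_gt0.
      have := divn_eq (ex z) t0; have := divn_eq (ex z') t0; rewrite e.
      have := ltn_pmod (ex z') C0; have := ltn_pmod (ex z) C0.
      set q := (_ %/ _) * _; clear; lia.
    move: zE z'E; rewrite inE => /andP[hz zt]; rewrite inE => /andP[hz' zt'] r hr.
    have := closed _ _ zt' (closedV _ _ zt hr) => /=.
    have -> //: (r / (yv th z / yv th s6) * (yv th z' / yv th s6) = g ^+ (ex z' - ex z) * r)%R.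
    have y6 := window_neq0 g0 (hY h6); have yz := window_neq0 g0 (hY hz).
    rewrite (exE _ hz') -(subnK (ltnW lt)) exprD.
    transitivity (r / yv th z * (g ^+ (ex z' - ex z) * (g ^+ ex z / g ^+ (1 * N))))%R.
      by field; rewrite y6 yz expf_neq0.
    by rewrite -(exE _ hz) subnK ?(ltnW lt) //; field.
  move: x'E; rewrite inE => /andP[nx x'E].
  case: (ltngtP (ex x) (ex x')) => [lt|lt|/val_inj eqx].
  - exact: key lt eb.
  - by apply: key lt _.
  - case/negP: nx; apply/eqP.
    have xX : x \in X by move: xE; rewrite inE => /andP[].
    have x'X : x' \in X by move: x'E; rewrite inE => /andP[].
    have : yv th x' = yv th x by rewrite (exE _ xX) (exE _ x'X) eqx.
    by rewrite /yv => /(mulIf (invr_neq0 th0))/addIr.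
(* [ratios] contains 1, hence every g^(t j). Dividing exponents by t with remainder covers the
   nonzero elements by t dilates of [ratios]. *)
have cR : #|F|.-1 <= t * #|ratios|.
  have pw j : (g ^+ (t * j) \in ratios)%R.
    elim: j => [|j IH]; first by rewrite muln0 expr0 ratios1.
    by rewrite mulnS exprD; apply: tcl.
  have -> : #|F|.-1 = #|[set z : F | z != 0%R]|.
    have := cardsC [set 0%R : F]; rewrite cards1 => <- /=.
    by apply: eq_card => z; rewrite !inE.
  rewrite -[t in t * _]card_ord -cardsT -cardsX.
  apply: leq_trans (leq_imset_card (fun lr : 'I_t * F => (g ^+ lr.1 * lr.2)%R) _).
  apply: subset_leq_card; apply/subsetP => z; rewrite inE => /g_gen[i ->].
  apply/imsetP; exists (Ordinal (ltn_pmod i tpos), g ^+ (t * (i %/ t)))%R.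
    by rewrite in_setX in_setT; exact: pw.
  by rewrite /= -exprD; congr (_ ^+ _)%R; rewrite mulnC addnC -divn_eq.
have q0 : 0 < #|F|.-1.
  by rewrite -ltnS prednK; apply: leq_trans (max_card X'); rewrite // ltnW.
(* The collision sets are disjoint inside X'^4, so the smallest has at most m^4 / |ratios|
   elements. *)
have [r0 hr0 hmin] := arg_minnP (fun r => #|collisions r|) ratios1.
have cB : #|F|.-1 * #|collisions r0| <= t * m ^ 4.
  have h1 : #|ratios| * #|collisions r0| <= m ^ 4.
    apply: leq_trans (card_dep_ge (B := collisions) hmin) _.
    rewrite -(@card_in_imset _ _ snd); last first.
      move=> [r w] [r' w']; rewrite inE /= => /andP[hr hw].
      rewrite inE /= => /andP[hr' hw'] ew.
      have [e1 _] := collisions_ratio hw (ratios_neq0 hr).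
      have [e2 _] := collisions_ratio hw' (ratios_neq0 hr').
      by rewrite ew e1 e2 ew.
    apply: (@leq_trans #|setX (setX X' X') (setX X' X')|).
      apply: subset_leq_card; apply/subsetP => _ /imsetP[[r w] + ->].
      by rewrite inE /= => /andP[_]; rewrite inE => /andP[].
    rewrite !cardsX (_ : m ^ 4 = m * m * (m * m)); last by ring.
    by rewrite !leq_mul.
  apply: leq_trans (leq_mul cR (leqnn _)) _.
  by rewrite -mulnA leq_mul2l h1 orbT.
pose B := [set w.1 | w in collisions r0].
have cB' : #|B| <= #|collisions r0| by apply: leq_imset_card.
have hB : 32 * (#|B| * n ^ 4) <= m ^ 2 * t1 ^ 2 * n ^ 2.
  rewrite -(leq_pmul2l q0).
  apply: (@leq_trans (32 * (t0 * m ^ 4) * n ^ 4)).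
    have h2 : #|F|.-1 * #|B| <= t0 * m ^ 4.
      apply: leq_trans (_ : t * m ^ 4 <= _); last by rewrite leq_mul2r (ltnW tt0) orbT.
      by apply: leq_trans cB; rewrite leq_mul2l cB' orbT.
    have -> : #|F|.-1 * (32 * (#|B| * n ^ 4)) = 32 * (#|F|.-1 * #|B|) * n ^ 4 by ring.
    by rewrite leq_mul2r leq_mul2l h2 !orbT.
  have -> : 32 * (t0 * m ^ 4) * n ^ 4 = 32 * t0 * m ^ 2 * n ^ 2 * (m ^ 2 * n ^ 2) by ring.
  have -> : #|F|.-1 * (m ^ 2 * t1 ^ 2 * n ^ 2) = t1 ^ 2 * #|F|.-1 * (m ^ 2 * n ^ 2) by ring.
  by rewrite leq_mul2r C3 orbT.
have TB := card_typical pos hB.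
have [s hs] : exists s, s \in typical B.
  apply/set0Pn; rewrite -card_gt0; move: TB n0; move: n #|typical B|; clear; nia.
(* Enlarging the exceptional set only removes links, so typical for B implies typical for the empty
   set. *)
have hs0 : s \in typical set0.
  move: hs; rewrite !inE => /andP[-> /=]; apply: leq_trans.
  rewrite leq_mul2l /=; apply: subset_leq_card; apply/subsetP => q; rewrite !inE => /andP[-> /=].
  apply: leq_trans; rewrite ltnS; apply: subset_leq_card.
  by apply/subsetP => w; rewrite !inE andbT => /andP[/andP[-> _] ->].
have := closedV _ _ hs0 hr0; apply/negP; apply: typical_ratio hs => //.
move=> u v u' v' hu hv hu' hv' hn e.
have [|neq] := eqVneq (u, v) (u', v'); first by case.
case/negP: hn; apply/imsetP; exists ((u, v), (u', v')) => //.
by rewrite !inE /= hu hv hu' hv' neq /= e eqxx.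
Qed.

End Pivot.

(** * Choice of the subset X' *)

Section Selection.
Variables (F : finFieldType) (g th : F) (N : nat).
Hypotheses (g0 : g != 0%R) (th0 : th != 0%R).
Hypothesis g_gen : forall z : F, z != 0%R -> exists i, z = (g ^+ i)%R.
Variable X : {set F}.
Hypothesis hX : forall x, x \in X -> x \in window g N 1.
Hypothesis hY : forall x, x \in X -> yv th x \in window g N 1.

(** Quotients of X lie in [window g N 2], so at most n^2 / 400 pairs have a quotient with fewer than
    t1 representations. A subset Z of size m keeps this density, and dropping the points with more
    than m / 20 bad partners leaves at least 19 m / 20. Any two remaining points then share at least
    17 m / 20 good intermediates. *)
Lemma solutions_bound m t0 t1 t2 :
  2 < m -> m <= #|X| -> t1 <= #|X| ->
  400 * (#|window g N 2| * t1) <= #|X| ^ 2 ->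
  0 < t0 -> 2 * (2 * N %/ t0).+1 < #|X| ->
  32 * (#|window g N 6| * t2) <= m ^ 2 * t1 ^ 2 * #|X| ^ 2 ->
  32 * t0 * m ^ 2 * #|X| ^ 2 <= t1 ^ 2 * #|F|.-1 ->
  m ^ 2 * t1 ^ 4 * t2 <= 8 * #|window g N 6| ^ 10.
Proof.
move=> m3 mn t1n hb C0 C1 C2 C3.
(* The diagonal is excluded to make [P] irreflexive; it is always good, since [tau X 1] is |X| >=
   t1. *)
pose P (c e : F) := (c != e) && (tau X (e / c)%R < t1).
have Pirr : irreflexive P by move=> c; rewrite /P eqxx.
have good c e : c \in X -> ~~ P c e -> t1 <= tau X (e / c)%R.
  move=> hc; rewrite /P negb_and negbK -leqNgt => /orP[/eqP <-|//].
  rewrite divff ?(window_neq0 g0 (hX hc)) //; apply: leq_trans t1n _.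
  by apply: subset_leq_card; apply/subsetP => x hx; rewrite inE mul1r hx.
have eX : 400 * edges P X <= #|X| ^ 2.
  apply: leq_trans hb; rewrite leq_mul2l /= edges_card.
  have := @card_unpopular _ _ (setX X X) setT (fun w : F * F => (w.2 / w.1)%R)
    (window g N 2) t1.
  rewrite setDT cards0 addn0 => H; apply: leq_trans (H _); last first.
    move=> [c e]; rewrite in_setX => /andP[hc he].
    exact: (@windowM F g N 1 1 _ _ (hX he) (windowV g0 (hX hc))).
  apply: subset_leq_card; apply/subsetP => -[c e]; rewrite !inE /=.
  move=> /andP[/andP[hc he] /andP[_ ht]]; rewrite hc he /=.
  apply: leq_ltn_trans ht; rewrite /tau.
  rewrite -(@card_in_imset _ _ fst); last first.
    move=> [a b] [a' b']; rewrite !inE /= => /andP[/andP[/andP[ha hb'] _] /eqP e1].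
    move=> /andP[/andP[/andP[ha' hb''] _] /eqP e2] ea; subst a'.
    have a0 := window_neq0 g0 (hX ha).
    by move: e2; rewrite -e1 => /(mulIf (invr_neq0 a0)) ->.
  apply: subset_leq_card; apply/subsetP => _ /imsetP[[a b] + ->].
  rewrite !inE /= => /andP[/andP[/andP[ha hb'] _] /eqP <-].
  by rewrite ha divfK // (window_neq0 g0 (hX ha)).
have [Z [ZX cZ eZ]] := sparse_subset Pirr mn.
have {}eZ : 400 * edges P Z <= m ^ 2.
  have n0 : 0 < #|X| ^ 2 by rewrite expn_gt0; apply/orP; left; apply: leq_trans mn; apply: leq_trans m3.
  rewrite -(leq_pmul2r n0) -mulnA; apply: leq_trans (leq_mul (leqnn 400) eZ) _.
  by rewrite mulnA mulnC leq_mul2l eX orbT.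
pose X' := [set c in Z | 20 * #|[set e in Z | P c e]| <= m].
have X'Z : X' \subset Z by apply/subsetP => c; rewrite inE => /andP[].
have X'X := subset_trans X'Z ZX.
have cX' : 19 * m <= 20 * #|X'|.
  pose e := (m %/ 20).+1.
  have mk := card_markov Z Z P e; rewrite -edges_card in mk.
  have cT : m = #|X'| + #|[set c in Z | e <= #|[set e in Z | P c e]|]|.
    rewrite -cZ -(cardsID X' Z); congr (_ + _).
      by congr #|pred_of_set _|; apply/setIidPr.
    apply: eq_card => c; rewrite in_setD [in LHS]inE [in RHS]inE.
    by case: (c \in Z); rewrite ?andbF //= andbT /e; clear; lia.
  have eK : m < 20 * e by rewrite /e; clear; lia.
  move: mk cT eK eZ m3; move: #|X'| #|[set c in Z | _]| (edges P Z) e; clear.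
  nia.
have X'm : #|X'| <= m by rewrite -cZ; apply: subset_leq_card.
have X'2 : 1 < #|X'| by move: cX' m3; move: #|X'|; clear; lia.
apply: (@pivot_bound F g th N g0 th0 g_gen X X' X'X hX hY m t0) => //.
move=> c d hc hd; set M := [set e in X' | _].
have cM : #|X'| <= #|M| + #|[set e in Z | P c e]| + #|[set e in Z | P d e]|.
  apply: (@leq_trans #|M :|: [set e in Z | P c e] :|: [set e in Z | P d e]|).
    apply: subset_leq_card; apply/subsetP => e he; rewrite in_setU in_setU.
    have eZ' := subsetP X'Z _ he.
    rewrite !(inE, eZ') /=; have := he; rewrite inE eZ' /= => ->.
    have := good c e (subsetP X'X _ hc); have := good d e (subsetP X'X _ hd).
    by case: (P c e); case: (P d e); rewrite ?orbT //= ?orbF => h1 h2; rewrite h1 ?h2.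
  apply: leq_trans (leq_card_setU _ _) _; rewrite leq_add2r.
  by have [] := leq_card_setU M [set e in Z | P c e].
move: hc hd; rewrite !inE => /andP[_ hc] /andP[_ hd].
move: cM hc hd cX'; move: #|M| #|X'| #|[set e in Z | P c e]| #|[set e in Z | P d e]|; clear; lia.
Qed.

End Selection.

(** * From the energy to the equation x = 1 + th y *)

Section Energy.
Variables (F : finFieldType) (g : F) (N : nat).
Hypothesis g0 : g != 0%R.
Hypothesis g_inj : forall i j, i < N -> j < N -> (g ^+ i.+1 = g ^+ j.+1)%R -> i = j.

Definition solutions (th : F) : {set F} :=
  [set x in window g N 1 | yv th x \in window g N 1].

Definition energy_set : {set ('I_N * 'I_N) * ('I_N * 'I_N)} :=
  [set q : ('I_N * 'I_N) * ('I_N * 'I_N) | g ^+ q.1.1.+1 + g ^+ q.1.2.+1 == g ^+ q.2.1.+1 + g ^+ q.2.2.+1]%R.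

Lemma ratio_window (i j : 'I_N) : (g ^+ i.+1 / g ^+ j.+1)%R \in window g N 1.
Proof.
apply/windowP; exists (i.+1 + N - j.+1); first by have := ltn_ord i; lia.
apply/eqP; rewrite eqr_div ?expf_neq0 // -!exprD.
by apply/eqP; congr (_ ^+ _)%R; have := ltn_ord j; lia.
Qed.

(** In g^i + g^j = g^k + g^l, the case j = l gives at most N^2. Otherwise put x = g^i / g^k, y = g^l
    / g^k and t = g^j / g^l, so that x = 1 + (1 - t) y with t <> 1; the triple (k, t, x) determines
    y, hence l, j and i. *)
Lemma energy_le J : (forall th, th != 0%R -> #|solutions th| <= J) ->
  #|energy_set| <= N ^ 2 + N * (#|window g N 1| * J).
Proof.
move=> hJ; pose D := [set q : ('I_N * 'I_N) * ('I_N * 'I_N) | q.1.2 == q.2.2].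
rewrite -(cardsID D); apply: leq_add.
  rewrite -(@card_in_imset _ _ fst); last first.
    move=> [[a b] [c d]] [[a' b'] [c' d']]; rewrite !inE /= => /andP[/eqP e1 /eqP e2].
    move=> /andP[/eqP e3 /eqP e4] [ea eb]; subst a' b' d d'.
    congr (_, (_, _)); apply: val_inj; apply: g_inj; rewrite ?ltn_ord //.
    by move: e1; rewrite e3 => /addIr.
  by apply: leq_trans (max_card _) _; rewrite card_prod !card_ord mulnn.
pose W := [set z : F * F | (z.1 \in window g N 1 :\ 1%R) && (z.2 \in solutions (1 - z.1)%R)].
have cW : #|W| <= #|window g N 1| * J.
  have := @card_dep_le _ _ (window g N 1 :\ 1%R) (fun t => solutions (1 - t)%R) J.
  move=> H; apply: leq_trans (H _) _.
    by move=> t; rewrite in_setD1 => /andP[ht _]; apply: hJ; rewrite subr_eq0 eq_sym.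
  by rewrite leq_mul2r; apply/orP; right; apply: subset_leq_card; apply: subD1set.
apply: (@leq_trans (#|'I_N| * #|W|)); last by rewrite card_ord leq_mul2l cW orbT.
rewrite -cardsT -cardsX.
pose f (q : ('I_N * 'I_N) * ('I_N * 'I_N)) : 'I_N * (F * F) :=
  (q.2.1, (g ^+ q.1.2.+1 / g ^+ q.2.2.+1, g ^+ q.1.1.+1 / g ^+ q.2.1.+1)%R).
have gn k : (g ^+ k != 0)%R by rewrite expf_neq0.
have key (x1 x2 x3 x4 : F) : (x2 != 0)%R -> (x3 != 0)%R -> x3 != x4 ->
    (x1 + x4 = x2 + x3)%R -> yv (1 - x4 / x3)%R (x1 / x2)%R = (x3 / x2)%R.
  move=> h2 h3 h34 e; have h34' : (x3 - x4 != 0)%R by rewrite subr_eq0.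
  have h5 : (1 - x4 / x3 != 0)%R.
    by rewrite subr_eq0 eq_sym; apply: contraNneq h34 => /divr1_eq ->.
  have -> : x1 = (x2 + x3 - x4)%R by rewrite -e addrK.
  by rewrite /yv; field; rewrite h2 h3 h34'.
have sol q : q \in energy_set :\: D ->
  yv (1 - g ^+ q.1.2.+1 / g ^+ q.2.2.+1)%R (g ^+ q.1.1.+1 / g ^+ q.2.1.+1)%R
   = (g ^+ q.2.2.+1 / g ^+ q.2.1.+1)%R /\ (g ^+ q.2.2.+1 != g ^+ q.1.2.+1)%R.
  rewrite !inE => /andP[hD /eqP e].
  have h34 : (g ^+ q.2.2.+1 != g ^+ q.1.2.+1)%R.
    by apply: contraNneq hD => /g_inj h; apply/eqP/val_inj; rewrite /= h.
  by split => //; apply: key.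
rewrite -(@card_in_imset _ _ f); last first.
  move=> q q' hq hq'; have [s1 _] := sol _ hq; have [s2 _] := sol _ hq'.
  move: hq hq' s1 s2; case: q => -[a b] [c d]; case: q' => -[a' b'] [c' d'] /=.
  move=> hq hq' s1 s2 [ec eb ea]; subst c'.
  have ed : d = d'.
    apply: val_inj; apply: g_inj; rewrite ?ltn_ord //.
    by apply: (mulIf (invr_neq0 (gn c.+1))); rewrite -s1 -s2 eb ea.
  subst d'.
  move: eb ea => /(mulIf (invr_neq0 (gn _))) eb /(mulIf (invr_neq0 (gn _))) ea.
  have -> : a = a' by apply: val_inj; apply: g_inj; rewrite ?ltn_ord.
  by have -> : b = b' by apply: val_inj; apply: g_inj; rewrite ?ltn_ord.
apply: subset_leq_card; apply/subsetP => _ /imsetP[q hq ->].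
have [e h34] := sol _ hq.
rewrite /f in_setX in_setT /= inE /= in_setD1 ratio_window andbT.
rewrite inE ratio_window e ratio_window andbT.
by rewrite andbT; apply: contraNneq h34 => /divr1_eq ->.
Qed.

End Energy.

(** * Transfer to the prime field *)

Lemma pow_expn a b : Nat.pow a b = a ^ b.
Proof. by elim: b => [|b IH] //=; rewrite IH expnS. Qed.

Lemma modulo_modn a p : 0 < p -> Nat.modulo a p = a %% p.
Proof.
move=> hp; symmetry; apply: (Nat.mod_unique a p (a %/ p)).
  by apply/ltP; rewrite ltn_mod.
by rewrite {1}(divn_eq a p) mulnC.
Qed.

Lemma div_divn a p : 0 < p -> Nat.div a p = a %/ p.
Proof.
move=> hp; symmetry; apply: (Nat.div_unique a p (a %/ p) (a %% p)).
  by apply/ltP; rewrite ltn_mod.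
by rewrite {1}(divn_eq a p) mulnC.
Qed.

Lemma prime_of_Zprime p : Znumtheory.prime (Z.of_nat p) -> prime p.
Proof.
move=> hp; have h1 := prime_ge_2 _ hp; apply/primeP; split; first by lia.
move=> d /dvdnP[k hk].
have : (Z.of_nat d | Z.of_nat p)%Z by exists (Z.of_nat k); rewrite hk; lia.
move=> /(prime_divisors _ hp) h; apply/orP.
by case: h => [|[|[|]]] h; [lia|left; apply/eqP; lia|right; apply/eqP; lia|lia].
Qed.

Lemma sum0_INR (f : nat -> nat) N : sum0 (fun i => INR (f i)) N = INR (\sum_(i < N) f i).
Proof.
elim: N => [|N IH]; first by rewrite big_ord0.
by rewrite big_ord_recr /= IH plus_INR.
Qed.

Section Bridge.
Variables (p g N : nat).
Hypothesis p_pr : prime p.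
Hypothesis groot : primitive_root p g.
Hypothesis Nge1 : 0 < N.
Hypothesis Np : N * N < p.
Let G : 'F_p := (g%:R)%R.

Let p0 : 0 < p. Proof. exact: prime_gt0. Qed.

Lemma Fp_eq_mod a b : ((a%:R : 'F_p) == b%:R)%R = (a %% p == b %% p).
Proof. by rewrite -val_eqE /= !val_Fp_nat. Qed.

Lemma Fp_root_order k : 0 < k < p.-1 -> (G ^+ k != 1)%R.
Proof.
move=> /andP[k0 kp]; have [_ h] := groot.
rewrite /G -natrX -[1%R]/(1%:R)%R Fp_eq_mod [1 %% p]modn_small ?prime_gt1 //.
apply/negP => /eqP e; apply: (h k); first by split; apply/ltP; lia.
by rewrite modulo_modn // pow_expn.
Qed.

Lemma Fp_root_unity : (G ^+ p.-1 = 1)%R.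
Proof.
have [h _] := groot; apply/eqP.
rewrite /G -natrX -[1%R]/(1%:R)%R Fp_eq_mod [1 %% p]modn_small ?prime_gt1 //.
apply/eqP; rewrite -h modulo_modn // pow_expn.
by congr (_ ^ _ %% _); lia.
Qed.

Lemma Fp_root_neq0 : (G != 0)%R.
Proof.
apply/eqP => e; have := Fp_root_unity; rewrite e expr0n.
have -> : (p.-1 == 0) = false by have := prime_gt1 p_pr; lia.
by move/eqP; rewrite eq_sym oner_eq0.
Qed.

Lemma Fp_root_inj i j : i < p.-1 -> j < p.-1 -> (G ^+ i = G ^+ j)%R -> i = j.
Proof.
have key a b : a < b -> b < p.-1 -> (G ^+ a = G ^+ b)%R -> False.
  move=> ab bp e; have /negP[] := @Fp_root_order (b - a) (ltac:(lia)).
  have Ga : (G ^+ a != 0)%R by rewrite expf_neq0 ?Fp_root_neq0.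
  by rewrite -(inj_eq (mulIf Ga)) -exprD subnK ?(ltnW ab) // e mul1r.
move=> hi hj e; case: (ltngtP i j) => // lt.
  by case: (key _ _ lt hj e).
by case: (key _ _ lt hi (esym e)).
Qed.

Lemma Fp_root_gen (z : 'F_p) : (z != 0)%R -> exists i, (z = G ^+ i)%R.
Proof.
pose f (i : 'I_p.-1) := (G ^+ i)%R.
have fi : injective f by move=> i j /Fp_root_inj h; apply: val_inj; apply: h.
have e : [set f i | i : 'I_p.-1] = [set~ 0%R].
  apply/eqP; rewrite eqEcard card_imset // cardsC1 card_Fp // card_ord leqnn andbT.
  apply/subsetP => _ /imsetP[i _ ->]; rewrite !inE.
  by rewrite expf_neq0 // Fp_root_neq0.
move=> hz; have : z \in [set~ 0%R] by rewrite !inE.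
by rewrite -e => /imsetP[i _ ->]; exists i.
Qed.

Lemma additive_energyE : additive_energy p g N = INR #|energy_set G N|.
Proof.
pose c i j k l : nat := ((((g ^ i.+1 + g ^ j.+1)%N%:R : 'F_p) == (g ^ k.+1 + g ^ l.+1)%N%:R)%R).
pose c3 i j k : nat := \sum_(l < N) c i j k l.
pose c2 i j : nat := \sum_(k < N) c3 i j k.
pose c1 i : nat := \sum_(j < N) c2 i j.
have sr u v : same_residue p u v = INR ((u%:R : 'F_p) == v%:R)%R.
  rewrite /same_residue Fp_eq_mod !modulo_modn //.
  by case: Nat.eqb_spec => h; case: eqP.
transitivity (sum0 (fun i => INR (c1 i)) N).
  apply: sum0_ext => i _; rewrite -(sum0_INR (c2 i)); apply: sum0_ext => j _.
  rewrite -(sum0_INR (c3 i j)); apply: sum0_ext => k _.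
  rewrite -(sum0_INR (c i j k)); apply: sum0_ext => l _.
  by rewrite sr !pow_expn.
rewrite sum0_INR /c1 /c2 /c3 /c; congr INR.
rewrite pair_big /=.
under eq_bigr => ij _ do rewrite pair_big /=.
rewrite pair_big /= -sum1_card [RHS]big_mkcond /=.
apply: eq_bigr => -[[i j] [k l]] _ /=; rewrite inE /=.
by rewrite !natrD !natrX; case: (_ == _).
Qed.

(** J is the maximum of |solutions th| over nonzero th, and [parameter_choice] is applied to a
    maximiser with q = p - 1. *)
Lemma energy_bound : exists J : nat,
  power_saving N J /\
  Rle (additive_energy p g N) (INR (N ^ 2 + N * ((2 * N + 1) * J))).
Proof.
have G0 := Fp_root_neq0.
have [th th0 hmax] := @arg_maxnP _ 1%R (fun th : 'F_p => th != 0%R)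
   (fun th => #|solutions G N th|) (oner_neq0 _).
exists #|solutions G N th|; split; last first.
  rewrite additive_energyE; apply: le_INR; apply/leP.
  apply: leq_trans (energy_le G0 _ hmax) _.
    (* Cancelling one factor [G] brings the exponents below N <= p - 1. *)
    move=> i j hi hj; rewrite !exprS => /(mulfI G0); apply: Fp_root_inj; nia.
  rewrite leq_add2l leq_mul2l leq_mul2r; apply/orP; right; apply/orP; right.
  by apply: leq_trans (card_window _ _ _) _; rewrite muln1.
have sX x : x \in solutions G N th -> x \in window G N 1 by rewrite inE => /andP[].
have sY x : x \in solutions G N th -> yv th x \in window G N 1 by rewrite [_ \in solutions _ _ _]inE => /andP[].
apply: (@parameter_choice _ N p.-1 #|window G N 2| #|window G N 6|).
- move=> m t0 t1 t2 h1 h2 h3 h4 h5 h6 h7 h8.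
  have := @solutions_bound _ G th N G0 th0 Fp_root_gen _ sX sY m t0 t1 t2.
  rewrite card_Fp // => H.
  move: h4 h6 h7 h8; rewrite !pow_expn div_divn; last by apply/ltP.
  move=> /leP h4 /ltP h6 /leP h7 /leP h8.
  by apply/leP; apply: H => //; apply/leP.
- by apply/leP.
- by apply/leP; rewrite -ltnS prednK.
- apply/leP; apply: leq_trans (_ : #|window G N 1| <= _).
    by apply: subset_leq_card; apply/subsetP => x; apply: sX.
  by apply: leq_trans (card_window _ _ _) _; rewrite muln1.
- by apply/leP; apply: leq_trans (card_window _ _ _) _.
- by apply/leP; apply: leq_trans (card_window _ _ _) _.
Qed.

End Bridge.

Lemma additive_energy_saving p g N :
  Znumtheory.prime (Z.of_nat p) -> primitive_root p g -> le 1 N -> lt (N * N) p ->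
  exists J : nat, power_saving N J /\
    Rle (additive_energy p g N) (INR (N ^ 2 + N * ((2 * N + 1) * J))).
Proof.
move=> /prime_of_Zprime p_pr groot /leP N1 /ltP Np; exact: energy_bound.
Qed.

End Combinatorics.

(** * The lower bound *)

Lemma pow_le_reg (a b : R) n : 0 <= b -> a ^ S n <= b ^ S n -> a <= b.
Proof.
  intros hb h. destruct (Rle_or_lt a b) as [k|k]; [exact k|exfalso].
  assert (b ^ S n < a ^ S n); [|lra].
  clear h. induction n as [|n IH]; [simpl; lra|].
  rewrite <- !(tech_pow_Rmult _ (S n)).
  apply Rle_lt_trans with (a * b ^ S n).
  - apply Rmult_le_compat_r; [apply pow_le; assumption|lra].
  - apply Rmult_lt_compat_l; [lra|assumption].
Qed.

(** With K = max (J, 1) the energy is at most 4 N^2 K, so lam^2 = 4 N K is allowed. The 40th power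
    of N / lam involves K^20 <= 10^80 N^19, and 200^40 = 4^20 * 10^80 absorbs the constants
    exactly. *)
Lemma avg_abs_sum_lower (p g N J : nat) :
  (0 < p)%nat -> (1 <= N)%nat -> power_saving N J ->
  additive_energy p g N <= INR (N ^ 2 + N * ((2 * N + 1) * J)) ->
  INR N <= (200 * avg_abs_sum p g N) ^ 40.
Proof.
  unfold power_saving. intros hp hN hJ hE. apply le_INR in hN. change (INR 1) with 1 in hN.
  rewrite plus_INR, pow_INR, !mult_INR, plus_INR, mult_INR in hE.
  change (INR 1) with 1 in hE. change (INR 2) with 2 in hE.
  set (y := INR N) in *. assert (hJ0 := pos_INR J).
  assert (y19 : 1 <= y ^ 19) by (apply pow_R1_Rle; assumption).
  assert (hK : exists K, 1 <= K /\ INR J <= K /\ K ^ 20 <= 10 ^ 80 * y ^ 19).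
  { destruct (Rle_or_lt 1 (INR J)) as [h|h].
    - exists (INR J). lra.
    - exists 1. rewrite pow1. lra. }
  destruct hK as [K [K1 [KJ hK]]].
  assert (hlam : 0 < 4 * y * K) by nra.
  assert (hs := sqrt_lt_R0 _ hlam).
  assert (hs2 : sqrt (4 * y * K) ^ 2 = 4 * y * K) by (apply pow2_sqrt; lra).
  set (lam := sqrt (4 * y * K)) in *.
  assert (hE2 : additive_energy p g N <= lam ^ 2 * y).
  { rewrite hs2. apply Rle_trans with (1 := hE).
    assert (y * ((2 * y + 1) * INR J) <= y * (3 * y * K)).
    { apply Rmult_le_compat_l; [lra|]. apply Rmult_le_compat; lra. }
    assert (y ^ 2 <= y ^ 2 * K) by (assert (0 <= y ^ 2) by apply pow2_ge_0; nra).
    nra. }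
  assert (h := avg_abs_sum_ge p g N lam hp hs hE2). fold y in h.
  assert (hq : 0 < y / lam) by (apply Rdiv_lt_0_compat; lra).
  apply Rle_trans with ((200 * (y / lam)) ^ 40).
  2: { apply pow_incr; lra. }
  assert (hl40 : lam ^ 40 = 4 ^ 20 * y ^ 20 * K ^ 20).
  { replace (lam ^ 40) with ((lam ^ 2) ^ 20) by (rewrite <- pow_mult; reflexivity).
    rewrite hs2, !Rpow_mult_distr. reflexivity. }
  assert (hl : 0 < lam ^ 40) by (apply pow_lt; assumption).
  unfold Rdiv. rewrite !Rpow_mult_distr, pow_inv.
  apply (Rmult_le_reg_r (lam ^ 40)); [assumption|].
  replace (200 ^ 40 * (y ^ 40 * / lam ^ 40) * lam ^ 40) with (200 ^ 40 * y ^ 40)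
    by (field; apply Rgt_not_eq; assumption).
  rewrite hl40.
  assert (y21 : 0 < y ^ 21) by (apply pow_lt; lra).
  replace (y * (4 ^ 20 * y ^ 20 * K ^ 20)) with (4 ^ 20 * y ^ 21 * K ^ 20) by ring.
  apply Rle_trans with (4 ^ 20 * y ^ 21 * (10 ^ 80 * y ^ 19)).
  - apply Rmult_le_compat_l; [lra|assumption].
  - replace (4 ^ 20 * y ^ 21 * (10 ^ 80 * y ^ 19)) with (200 ^ 40 * y ^ 40) by ring. lra.
Qed.

(* "LHS >> N^{1/48 + o(1)}": for every eps > 0 there are c > 0 and N0 with
   LHS >= c * N^(1/48 - eps) for all p, g, N with N >= N0. *)
Theorem theorem5 :
  forall eps : R, 0 < eps ->
  exists c : R, 0 < c /\
  exists N0 : nat,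
  forall p g N : nat,
    prime (Z.of_nat p) ->
    primitive_root p g ->
    (1 <= N)%nat -> (N0 <= N)%nat ->
    INR N < sqrt (INR p) ->
    avg_abs_sum p g N >= c * Rpower (INR N) (1/48 - eps).
Proof.
  intros eps heps. exists (/ 200). split; [lra|]. exists 1%nat.
  intros p g N hp hg hN _ hlt.
  assert (hp2 := prime_ge_2 _ hp).
  assert (hy : 1 <= INR N) by (apply le_INR in hN; exact hN).
  assert (hNp : (N * N < p)%nat).
  { apply INR_lt. rewrite mult_INR.
    assert (hs := pos_INR p). rewrite <- (sqrt_sqrt _ hs).
    apply Rmult_le_0_lt_compat; lra. }
  destruct (Combinatorics.additive_energy_saving hp hg hN hNp) as [J [hJ hE]].
  (* The bound comes with the [expn] of MathComp and is turned back into [Nat.pow]. *)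
  rewrite <- Combinatorics.pow_expn in hE.
  assert (h := avg_abs_sum_lower p g N J ltac:(lia) hN hJ hE).
  assert (ha : 0 <= avg_abs_sum p g N).
  { unfold avg_abs_sum. apply Rmult_le_pos.
    - apply Rlt_le, Rinv_0_lt_compat, lt_0_INR; lia.
    - apply sum0_ge0; intros; apply exp_sum_abs_ge0. }
  set (r := Rpower (INR N) (1/48 - eps)).
  assert (hr : r <= 200 * avg_abs_sum p g N); [|lra].
  (* Compare 40th powers: 40 (1/48 - eps) <= 1. *)
  apply (pow_le_reg _ _ 39); [lra|].
  apply Rle_trans with (2 := h).
  unfold r. rewrite <- Rpower_pow by apply exp_pos.
  rewrite Rpower_mult.
  rewrite <- (Rpower_1 (INR N)) at 2 by lra.
  apply Rle_Rpower; [exact hy|].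
  replace (INR 40) with 40 by (rewrite INR_IZR_INZ; reflexivity). lra.
Qed.
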